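(* Let $\pi=(d_0,\dots,d_{n-1})$ be a tree degree sequence, let $\mathcal{T}_\pi$ be the set of all trees with degree sequence $\pi$, and let $T_\pi^*$ be the greedy tree with degree sequence $\pi$. Then for every $T\in\mathcal{T}_\pi$ and every integer $k\ge 0$, $$C(k;T)\lhd_w C(k;T_\pi^* ).$$ In other words, for each $r=0,\dots,n-1$, $$\max_{T\in\mathcal{T}_\pi}\ \max_{U\subseteq V(T),\,|U|=r}\ \sum_{v\in U}C_v(k;T)=\sum_{v\in U^*}C_v(k;T_\pi^* ),$$ where $U^*$ is the set of the first $r$ vertices of $T_\pi^*$ in a BFS-ordering.
   Context: Graphs are finite and simple. For a vertex $v$ of a graph $G$ and an integer $k\ge 0$, $C_v(k;G)$ is the number of closed walks of length $k$ in $G$ starting at $v$, i.e. sequences $w_1,\dots,w_{k+1}$ of vertices with consecutive ones adjacent and $w_1=w_{k+1}=v$; $C(k;G)=(C_v(k;G))_{v\in V(G)}$. A tree degree sequence is a nonincreasing sequence of nonnegative integers that is the degree sequence of some tree. Weak majorization: for nonnegative sequences $\alpha=(x_0,\dots,x_{n-1})$, $\beta=(y_0,\dots,y_{n-1})$ of the same length with nonincreasing rearrangements $x_{[0]}\ge\dots\ge x_{[n-1]}$ and $y_{[0]}\ge\dots\ge y_{[n-1]}$, write $\alpha\lhd_w\beta$ if $\sum_{i=0}^t x_{[i]}\le\sum_{i=0}^t y_{[i]}$ for all $t=0,\dots,n-1$. Greedy tree: in a rooted tree, the height (level) $h(v)$ of a vertex is its distance to the root, and $f(v)$ denotes the father of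 a non-root vertex $v$. A BFS-ordering is a total ordering $\prec$ of the vertices such that vertices of smaller level come before vertices of larger level and, for all $u\prec v$ in the same level: (1) $d(u)\ge d(v)$; (2) if $u,v$ are not roots, then $f(u)=f(v)$ or $f(u)\prec f(v)$. A greedy tree is a rooted tree (one root) admitting a BFS-ordering and such that every degree of a vertex at level $i$ is at least every degree of a vertex at level $i+1$, for all $i$. For each tree degree sequence $\pi$ there is exactly one (up to isomorphism) greedy tree with degree sequence $\pi$, denoted $T_\pi^*$. *)

(* Defs.v *)
From mathcomp Require Import all_boot.

Set Implicit Arguments.
Unset Strict Implicit.
Unset Printing Implicit Defensive.

Record sgraph (V : finType) := SGraph {
  adj :> rel V;
  adj_sym : symmetric adj;
  adj_irr : irreflexive adj
}.

Section Graph.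
Variables (V : finType) (G : sgraph V).

Definition deg (v : V) : nat := #|[set u | adj G v u]|.

(* The nonincreasing list of all degrees. *)
Definition degree_sequence : seq nat := sort geq [seq deg v | v : V].

(* A [ucycle] of size 1 is a loop and one of size 2 is an edge traversed back
   and forth, so the graph-theoretic cycles are the ones of size at least 3. *)
Definition acyclic : Prop := forall c : seq V, ucycle (adj G) c -> size c <= 2.

Definition connected : Prop := forall u v : V, connect (adj G) u v.

Definition is_tree : Prop := [/\ 0 < #|V|, connected & acyclic].

(* [w] is the walk w_1, ..., w_{k+1}, indexed here from 0 to k. *)
Definition closed_walks (k : nat) (v : V) : nat :=
  #|[set w : k.+1.-tuple V |
      [&& sorted (adj G) w, tnth w ord0 == v & tnth w ord_max == v]]|.

Definition closed_walk_seq (k : nat) : seq nat :=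
  [seq closed_walks k v | v : V].

(* Least length of a walk from [u] to [v]; it is less than #|V| whenever such
   a walk exists, and the value is #|V| otherwise. *)
Definition dist (u v : V) : nat :=
  find (fun l => [exists p : l.-tuple V, path (adj G) u p && (last u p == v)])
       (iota 0 #|V|).

Section Rooted.
Variable root : V.

Definition level (v : V) : nat := dist root v.

(* In a tree the neighbour picked is unique when [v] is not the root; the
   default value [v] is only used for the root. *)
Definition father (v : V) : V :=
  odflt v [pick u | adj G v u && (level v == (level u).+1)].

Definition strict_total_order (prec : rel V) : Prop :=
  [/\ irreflexive prec, transitive prec
    & forall u v, u != v -> prec u v || prec v u].

Definition bfs_ordering (prec : rel V) : Prop :=
  [/\ strict_total_order prec,
      forall u v, level u < level v -> prec u v
    & forall u v, prec u v -> level u = level v ->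
        deg v <= deg u /\
        (u != root -> v != root ->
           father u = father v \/ prec (father u) (father v))].

Definition greedy_tree : Prop :=
  [/\ is_tree,
      exists prec : rel V, bfs_ordering prec
    & forall u v, level v = (level u).+1 -> deg v <= deg u].

End Rooted.

(* The first [r] vertices for the ordering [prec]. *)
Definition first_vertices (prec : rel V) (r : nat) : {set V} :=
  [set v | #|[set u | prec u v]| < r].

End Graph.

Definition in_trees (pi : seq nat) (V : finType) (T : sgraph V) : Prop :=
  is_tree T /\ degree_sequence T = pi.

Definition tree_degree_sequence (pi : seq nat) : Prop :=
  exists (V : finType) (T : sgraph V), in_trees pi T.

Definition weakly_majorized (a b : seq nat) : Prop :=
  size a = size b /\
  forall t, t < size a ->
    \sum_(i < t.+1) nth 0 (sort geq a) i <= \sum_(i < t.+1) nth 0 (sort geq b) i.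

Definition is_maximum (S : nat -> Prop) (m : nat) : Prop :=
  S m /\ forall x, S x -> x <= m.

(* Main.v *)
(* A closed walk in a tree splits at its passages through a fixed edge, so that
   the numbers of closed walks satisfy recursions with nonnegative coefficients
   along any rooting of the tree at a vertex or at an edge.  Weak majorization
   by decreasing sequences is compatible with these recursions, level by level:
   hence rearranging a rooted tree, keeping its levels and degrees, so that on
   each level the vertices of larger degree come first and have the first
   children increases the closed walk sequences of all lengths.  It also does
   not decrease the sum of the squared sizes of the two sides of the edges (an
   affine decreasing function of the Wiener index), and keeps it constant only
   if the tree was already arranged by subtree sizes.  Rooting a tree at its
   centroid, a vertex of smaller degree on an earlier level than a vertex of
   larger degree would violate this at the middle edge of the path between two
   such vertices on consecutive levels; so rearrangements at edges lead to a tree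
   whose degrees decrease along the levels from its centroid.  Its levels have
   the same degrees as those of the greedy tree, which is a rearrangement of it. *)

Require Import Defs.
From mathcomp Require Import all_boot zify.

Set Implicit Arguments.
Unset Strict Implicit.
Unset Printing Implicit Defensive.

(** The recursions multiply counts, and majorization passes through a product by Abel summation
    along an order in which the weights decrease. One ordering of each level therefore has to serve
    all walk lengths at once, and the majorizations are proved next to the fact that the counts of
    the rearranged tree decrease along its ordering. Walks inside a branch only see the children;
    walks that leave it see the father, so majorization must also be carried down from each level to
    the next. Roots at an edge are needed because vertices on consecutive levels lie at an odd
    distance: no vertex sees them on a common level, but an edge can. Progress is measured by
    squares because the sum of the branch sizes over a level depends on the levels alone, while the
    sum of their squares can only grow and stays constant only if the sizes themselves do. Adding
    the squares of both sides of every edge makes the measure independent of the root, which changes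
    from one rearrangement to the next. *)

(** * Shifted convolutions *)

(** The sum runs over pairs of lengths with sum [k - 1]: the missing unit is a step across the edge
    that separates the two factors. On generating functions this is the product times the
    variable. *)
Definition conv (f g : nat -> nat) (k : nat) : nat :=
  \sum_(a < k) f a * g (k.-1 - a).

Lemma conv0 f g : conv f g 0 = 0.
Proof. by rewrite /conv big_ord0. Qed.

Lemma convSl f g k : conv f g k.+1 = f 0 * g k + conv (f \o succn) g k.
Proof.
rewrite /conv big_ord_recl /= subn0; congr (_ + _).
by apply: eq_bigr => i _ /=; rewrite /bump /= add1n subnS -predn_sub.
Qed.

Lemma conv_suml (I : finType) (P : pred I) (F : I -> nat -> nat) g k :
  conv (fun a => \sum_(i | P i) F i a) g k = \sum_(i | P i) conv (F i) g k.
Proof.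
rewrite /conv exchange_big /=; apply: eq_bigr => a _.
by rewrite big_distrl.
Qed.

Lemma leq_conv f g f' g' k :
  (forall a, a < k -> f a <= f' a) -> (forall a, a < k -> g a <= g' a) ->
  conv f g k <= conv f' g' k.
Proof.
move=> lf lg; apply: leq_sum => a _; apply: leq_mul; first exact: lf.
by apply: lg; apply: leq_ltn_trans (leq_subr _ _) _; rewrite prednK // (leq_trans _ (ltn_ord a)).
Qed.

Lemma eq_conv f g f' g' k : f =1 f' -> g =1 g' -> conv f g k = conv f' g' k.
Proof. by move=> ef eg; apply: eq_bigr => a _; rewrite ef eg. Qed.

(** * Walks confined to a set of vertices *)

Section Walks.
Variables (V : finType) (G : sgraph V).
Implicit Types (P A : {set V}) (u v w x y z : V).

Fixpoint nwalks P k u v : nat :=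
  if k is k'.+1 then
    if u \in P then \sum_(w | adj G u w) nwalks P k' w v else 0
  else (u \in P) && (u == v).

Lemma nwalks_notin P k u v : u \notin P -> nwalks P k u v = 0.
Proof. by case: k => [|k] /= /negbTE->. Qed.

Lemma nwalksS P k u v : u \in P ->
  nwalks P k.+1 u v = \sum_(w | adj G u w) nwalks P k w v.
Proof. by move=> /= ->. Qed.

Lemma sum_delta (Q : pred V) v (b : V -> bool) :
  \sum_(w | Q w) ((w == v) && b w) = Q v && b v.
Proof.
rewrite big_mkcond (bigD1 v) //= eqxx big1 ?addn0 /=; first by case: (Q v).
by move=> w /negbTE->; case: ifP.
Qed.

Lemma nwalksSr P k u v : nwalks P k.+1 u v =
  if v \in P then \sum_(w | adj G w v) nwalks P k u w else 0.
Proof.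
elim: k u => [|k IH] u.
  rewrite /=; under eq_bigr do rewrite andbC; rewrite sum_delta.
  under [in RHS]eq_bigr do rewrite andbC eq_sym; rewrite sum_delta.
  by case: (u \in P); case: (v \in P); rewrite ?andbF ?andbT.
rewrite -[LHS]/(if u \in P then \sum_(w | adj G u w) nwalks P k.+1 w v else 0); case: ifP => uP; last first.
  by case: ifP => // _; rewrite big1 // => w _; rewrite nwalks_notin ?uP.
under eq_bigr do rewrite IH.
case: ifP => vP; last by rewrite big1.
by rewrite exchange_big; apply: eq_bigr => w _ /=; rewrite uP.
Qed.

Lemma nwalks_sym P k u v : nwalks P k u v = nwalks P k v u.
Proof.
elim: k u v => [|k IH] u v.
  by rewrite /= eq_sym; case: eqP => [->|]; rewrite ?andbF.
rewrite nwalksSr [RHS]/=; case: ifP => // _.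
by apply: eq_big => [w|w _]; rewrite ?(adj_sym G w).
Qed.

(* A walk that leaves [A], hence through the only exit [x -> y], is cut at its
   first step from [x] to [y]. *)
Lemma nwalks_glue P A x y z :
  A \subset P -> x \in A -> y \in P -> y \notin A -> adj G x y ->
  (forall u v, u \in A -> v \in P -> v \notin A -> adj G u v -> u = x /\ v = y) ->
  z \notin A -> forall k u, u \in A ->
  nwalks P k u z = conv (fun a => nwalks A a u x) (fun a => nwalks P a y z) k.
Proof.
move=> sAP xA yP yA xy cut zA; elim=> [|k IH] u uA.
  rewrite conv0 /=; case: eqP => [uz|]; last by rewrite andbF.
  by rewrite -uz uA in zA.
have uP : u \in P by apply: (subsetP sAP).
rewrite (nwalksS _ _ uP) convSl /= uA /= (bigID [in A]) /= addnC; congr (_ + _).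
  case: (u =P x) => [->|nux].
    rewrite mul1n (bigD1 y) ?xy //= big1 ?addn0 // => w /andP[/andP[xw wA] nwy].
    case: (boolP (w \in P)) => wP; last exact: nwalks_notin.
    by have [_ E] := cut _ _ xA wP wA xw; rewrite E eqxx in nwy.
  rewrite mul0n big1 // => w /andP[uw wA].
  case: (boolP (w \in P)) => wP; last exact: nwalks_notin.
  by have [E] := cut _ _ uA wP wA uw; case: nux.
rewrite (eq_bigr _ (fun w H => IH w (proj2 (andP H)))) -conv_suml.
apply: eq_conv => // a /=; rewrite uA [RHS](bigID [in A]) /= [X in _ + X]big1 ?addn0 //.
by move=> w /andP[_]; apply: nwalks_notin.
Qed.

Lemma card_tuple_path k u v :
  #|[set p : k.-tuple V | path (adj G) u p && (last u p == v)]|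
  = nwalks setT k u v.
Proof.
elim: k u => [|k IH] u.
  rewrite /= inE /=; case: eqP => [->|nuv].
    rewrite (_ : finset _ = setT) ?cardsT ?card_tuple //.
    by apply/setP => p; rewrite !inE (tuple0 p) /= eqxx.
  rewrite (_ : finset _ = set0) ?cards0 //.
  by apply/setP => p; rewrite !inE (tuple0 p) /=; apply/eqP.
rewrite [RHS]/= inE -sum1dep_card big_mkcond /=.
rewrite (reindex (fun q : V * k.-tuple V => [tuple of q.1 :: q.2])) /=; last first.
  exists (fun t : k.+1.-tuple V => (thead t, [tuple of behead t])).
    by move=> [w t] _ /=; congr pair; apply/val_inj.
  by move=> t _; rewrite [RHS]tuple_eta.
rewrite -(pair_bigA _ (fun w (t : k.-tuple V) =>
  if adj G u w && path (adj G) w t && (last w t == v) then 1 else 0)) /=.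
rewrite [RHS]big_mkcond /=; apply: eq_bigr => w _; case: ifP => uw /=.
  by rewrite -IH -sum1dep_card [RHS]big_mkcond.
by rewrite big1.
Qed.

Lemma closed_walksE k v : closed_walks G k v = nwalks setT k v v.
Proof.
rewrite -card_tuple_path /closed_walks.
rewrite -(card_imset _ (f := fun p : k.-tuple V => [tuple of v :: p])); last first.
  by move=> p q /(congr1 (behead \o val)) /= E; apply/val_inj.
apply: eq_card => t; rewrite inE; apply/idP/imsetP.
  case: t / tupleP => h p; rewrite !(tnth_nth v) /= => /and3P[ph /eqP <- pl].
  exists p => //; rewrite inE ph /=; move: pl.
  by rewrite (last_nth h) size_tuple.
case=> p; rewrite inE => /andP[pp lp] ->; rewrite /= pp /=.
rewrite !(tnth_nth v) /= eqxx /=.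
by move: lp; rewrite (last_nth v) size_tuple.
Qed.

End Walks.

(** * Sides of an edge and the recursions for closed walks *)

Section Sides.
Variables (V : finType) (G : sgraph V).
Implicit Types (A : {set V}) (u v w x y z c : V).

Definition cut x y : rel V :=
  [rel u v | adj G u v && ~~ [|| (u == x) && (v == y) | (u == y) && (v == x)]].

Definition side x y : {set V} := [set z | connect (cut x y) x z].

Lemma cut_sym x y : symmetric (cut x y).
Proof.
move=> u v; rewrite /cut /= adj_sym; congr (_ && ~~ _).
by rewrite orbC ![(v == _) && _]andbC.
Qed.

Lemma cutC x y : cut x y =2 cut y x.
Proof. by move=> u v; rewrite /cut /= orbC. Qed.

Lemma adj_neq u v : adj G u v -> u != v.
Proof. by apply: contraTneq => ->; rewrite adj_irr. Qed.

Lemma side_refl x y : x \in side x y.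
Proof. by rewrite inE. Qed.

Lemma side_step x y u v : u \in side x y -> cut x y u v -> v \in side x y.
Proof. by rewrite !inE => xu uv; apply: connect_trans xu (connect1 uv). Qed.

Lemma connect_closed (e : rel V) A x z :
  (forall u v, u \in A -> e u v -> v \in A) -> connect e x z -> x \in A -> z \in A.
Proof.
move=> clA /connectP[p pp ->]; elim: p x pp => //= y p IH x /andP[xy pp] xA.
by apply: IH pp _; apply: clA xA xy.
Qed.

Lemma connect_in (e e' : rel V) A x z : x \in A ->
  (forall u v, u \in A -> e u v -> v \in A) ->
  (forall u v, u \in A -> v \in A -> e u v -> e' u v) ->
  connect e x z -> connect e' x z.
Proof.
move=> xA clA ee' /connectP[p pp ->]; elim: p x xA pp => //= y p IH x xA /andP[xy pp].
have yA := clA _ _ xA xy.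
by apply: connect_trans (connect1 (ee' _ _ xA yA xy)) (IH _ yA pp).
Qed.

Hypothesis treeG : is_tree G.

Let connG u v : connect (adj G) u v. Proof. by case: treeG. Qed.

(* Otherwise a path from x to y avoiding the edge xy closes up to a cycle. *)
Lemma side_notin x y : adj G x y -> y \notin side x y.
Proof.
move=> xy; apply/negP; rewrite inE => /connectP[p pp E].
case/shortenP: pp E => q pq uq _ E.
have acy : acyclic G by case: treeG.
suff: size (x :: q) <= 2.
  case: q pq uq E => [_ _ E|a [|b q]] //=.
    by rewrite /= in E; rewrite E adj_irr in xy.
  by rewrite andbT => /andP[_ nE] _ E; rewrite -E !eqxx in nE.
apply: acy; rewrite /ucycle uq /= rcons_path andbT -E adj_sym xy andbT.
by apply: sub_path pq => u v /andP[].
Qed.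

Lemma side_exit x y u v : adj G x y -> u \in side x y -> v \notin side x y ->
  adj G u v -> u = x /\ v = y.
Proof.
move=> xy uS vS uv.
have: ~~ cut x y u v by apply: contra vS; apply: side_step.
rewrite /cut /= uv /= negbK => /orP[/andP[/eqP-> /eqP->] //|/andP[/eqP uy _]].
by rewrite uy (negbTE (side_notin xy)) in uS.
Qed.

(** A path inside [side c x] never meets [x], so it survives the removal of any other edge at [x]
    just as well. *)
Lemma side_connect c x y z : adj G c x -> z \in side c x -> connect (cut x y) c z.
Proof.
move=> cx zS; have xS : x \notin side c x by apply: side_notin.
apply: (@connect_in (cut c x) _ (side c x)); first exact: side_refl.
- by move=> u v uS; apply: side_step uS.
- move=> u v uS vS /andP[uv _]; rewrite /cut /= uv /=.
  have /negbTE-> : u != x by apply: contraTneq uS => ->.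
  have /negbTE-> : v != x by apply: contraTneq vS => ->.
  by rewrite andbF.
- by rewrite inE in zS.
Qed.

Lemma side_sub x y c : adj G c x -> c != y -> side c x \subset side x y.
Proof.
move=> cx cy; apply/subsetP => z zS.
rewrite inE; apply: connect_trans (side_connect y cx zS).
apply: connect1; rewrite /cut /= adj_sym cx (negbTE cy) andbF /= negb_and orbC.
by rewrite (adj_neq cx).
Qed.

Lemma side_disjoint x c c' z : adj G c x -> adj G c' x ->
  z \in side c x -> z \in side c' x -> c = c'.
Proof.
move=> cx c'x zS zS'; apply/eqP; apply/negPn/negP => ncc.
have /negP[] := side_notin cx; rewrite inE.
have H := side_connect c c'x zS'.
rewrite inE in zS; apply: connect_trans zS _.
apply: (@connect_trans _ _ c').
  by rewrite (sym_connect_sym (cut_sym c x)) (eq_connect (cutC c x)).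
apply: connect1; rewrite /cut /= c'x /= eq_sym (negbTE ncc) /=.
by rewrite negb_and (adj_neq c'x).
Qed.

Lemma side_split x y z : z \in side x y -> z != x ->
  exists c, [/\ adj G c x, c != y & z \in side c x].
Proof.
rewrite inE => /connectP[p pp ->]; case/shortenP: pp => q pq uq _.
case: q pq uq => [|c q] /=; first by rewrite eqxx.
rewrite inE negb_or => /andP[/andP[xc xy] pq] /andP[/andP[nxc nxq] uq] _.
exists c; split; first by rewrite adj_sym.
  by apply: contraNneq xy => ->; rewrite !eqxx.
rewrite inE; apply/connectP; exists q => //.
apply: (sub_in_path (P := [pred u | u != x])) pq.
  move=> u v; rewrite !inE => ux vx /andP[uv _].
  by rewrite /cut /= uv (negbTE ux) (negbTE vx) !andbF.
rewrite /= eq_sym nxc; apply/allP => u uq'; rewrite inE.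
by apply: contraNneq nxq => <-.
Qed.

Lemma card_side x y :
  #|side x y| = (\sum_(c | adj G x c && (c != y)) #|side c x|).+1.
Proof.
rewrite (cardD1 x) side_refl add1n; congr _.+1.
rewrite -sum1_card (eq_bigl (fun z => [exists c, [&& adj G x c, c != y & z \in side c x]])).
  under [RHS]eq_bigr do rewrite -sum1_card.
  rewrite (exchange_big_dep (fun z => [exists c, [&& adj G x c, c != y & z \in side c x]])) /=.
    apply: eq_bigr => z /existsP[c /and3P[xc cy zS]].
    rewrite (bigD1 c) /= ?xc ?cy //= big1 // => c' /andP[/andP[/andP[xc' _] zS'] ncc].
    case/eqP: ncc; apply: (side_disjoint (x := x) (z := z)) => //; by rewrite adj_sym.
  by move=> c z /andP[xc cy] zS; apply/existsP; exists c; rewrite xc cy.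
move=> z; rewrite !inE; apply/andP/existsP => [[zx zS]|[c /and3P[xc cy zS]]].
  have [|c [cx cy zc]] := side_split _ zx (y := y); first by rewrite inE.
  by exists c; rewrite adj_sym cx cy.
rewrite adj_sym in xc; split.
  by apply: contraTneq zS => ->; apply: side_notin.
by have := subsetP (side_sub xc cy) _ zS; rewrite inE.
Qed.

Lemma sideC x y : adj G x y -> side y x = ~: side x y.
Proof.
move=> xy; have yx : adj G y x by rewrite adj_sym.
apply/setP => z; rewrite in_setC.
have disj : ~~ ((z \in side x y) && (z \in side y x)).
  apply/negP => /andP[]; rewrite !inE => xz yz; have /negP[] := side_notin xy.
  rewrite inE; apply: connect_trans xz _.
  by rewrite (sym_connect_sym (cut_sym x y)) (eq_connect (cutC x y)).
suff: z \in side x y :|: side y x.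
  by rewrite inE; move: disj; do 2!case: (z \in _).
have clA u v : u \in side x y :|: side y x -> adj G u v -> v \in side x y :|: side y x.
  rewrite 2!in_setU => uS uv; case: (boolP (v \in side x y)) => //= vS.
  case/orP: uS => uS; first by have [_ ->] := side_exit xy uS vS uv; apply: side_refl.
  apply: contraR vS => vS; have [_ ->] := side_exit yx uS vS uv.
  exact: side_refl.
by apply: (connect_closed clA (connG x z)); rewrite inE side_refl.
Qed.

(** Without loops, cutting at [x = y] removes nothing. This degenerate case lets a vertex root,
    which is its own father, share the recursions written with [side v (fa v)]. *)
Lemma sidexx x : side x x = setT.
Proof.
apply/setP => z; rewrite !inE (eq_connect (e' := adj G)) ?connG // => u v.
rewrite /cut /=; case: (boolP (adj G u v)) => //= /adj_neq uv; rewrite orbb.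
by apply/negP => /andP[/eqP ux /eqP vx]; rewrite ux vx eqxx in uv.
Qed.

(** When [y] is the father of [x], [side x y] is the branch of [x]: the vertex together with its
    descendants. Then [swalks] adds up the counts of the branches of the children. *)
Definition dwalks x y k := nwalks G (side x y) k x x.

Definition cwalks x k := nwalks G setT k x x.

Definition swalks x y k := \sum_(c | adj G x c && (c != y)) dwalks c x k.

Lemma dwalks0 x y : dwalks x y 0 = 1.
Proof. by rewrite /dwalks /= side_refl eqxx. Qed.

Lemma cwalks0 x : cwalks x 0 = 1.
Proof. by rewrite /cwalks /= inE eqxx. Qed.

Lemma dwalksxx x k : dwalks x x k = cwalks x k.
Proof. by rewrite /dwalks sidexx. Qed.

Lemma nwalks_side A c x z k : adj G c x -> side c x \subset A -> x \in A ->
  z \notin side c x ->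
  nwalks G A k c z = conv (dwalks c x) (fun b => nwalks G A b x z) k.
Proof.
move=> cx sA xA zS.
rewrite (nwalks_glue sA (side_refl c x) xA (side_notin cx) cx) ?side_refl //.
by move=> u v uS _ vS; apply: side_exit.
Qed.

(** First return: a step to [c], a closed walk on the side of [c], a step back, and the rest of the
    walk. The two steps across the edge leave a total length [k - 1] for the two factors of
    [conv]. *)
Lemma dwalksS x y k : dwalks x y k.+1 = conv (swalks x y) (dwalks x y) k.
Proof.
rewrite /dwalks nwalksS ?side_refl // (bigID (fun c => c != y)) /= addnC.
rewrite big1 ?add0n => [|c /andP[xc /negPn/eqP cy]]; last first.
  by rewrite nwalks_notin // cy side_notin -?cy.
rewrite conv_suml; apply: eq_bigr => c /andP[xc cy].
rewrite adj_sym in xc.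
by rewrite (nwalks_side k xc (side_sub xc cy) (side_refl _ _) (side_notin xc)).
Qed.

Lemma nwalksT_side x y k : adj G x y ->
  nwalks G setT k x y = conv (dwalks x y) (cwalks y) k.
Proof. by move=> xy; exact: nwalks_side (subsetT _) (in_setT _) (side_notin xy). Qed.

(** First steps to [y] are kept apart. The walks that then remain are expanded by [nwalksT_side] at
    a non-root vertex, and get the recursion [nwalksT_adjS] of their own at an edge root. *)
Lemma cwalksS x y k : adj G x y ->
  cwalks x k.+1 = conv (swalks x y) (cwalks x) k + nwalks G setT k x y.
Proof.
move=> xy; rewrite /cwalks nwalksS ?inE // (bigD1 y) //= addnC.
congr (_ + _); last exact: nwalks_sym.
rewrite conv_suml; apply: eq_bigr => c /andP[xc cy].
by rewrite adj_sym in xc; rewrite (nwalks_side k xc (subsetT _) (in_setT _) (side_notin xc)).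
Qed.

Lemma nwalksT_adjS x y k : adj G x y -> nwalks G setT k.+1 x y =
  conv (swalks x y) (fun a => nwalks G setT a x y) k + cwalks y k.
Proof.
move=> xy; rewrite nwalksS ?inE // (bigD1 y) //= addnC; congr (_ + _).
rewrite conv_suml; apply: eq_bigr => c /andP[xc cy].
rewrite adj_sym in xc; rewrite (nwalks_side k xc (subsetT _) (in_setT _)) //.
apply: contra cy => yS; apply/eqP.
apply: (side_disjoint (x := x) xc _ yS (side_refl y x)); by rewrite adj_sym.
Qed.

Lemma card_sideC x y : adj G x y -> #|side x y| + #|side y x| = #|V|.
Proof. by move=> xy; rewrite (sideC xy) cardsC. Qed.

(** Among the oriented edges whose near side has more than half of the vertices, one with smallest
    near side starts at a centroid: another heavy side at that vertex would lie strictly inside the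
    first. If there is no such edge, any vertex will do. *)
Lemma exists_centroid :
  exists v, forall c, adj G c v -> #|side c v|.*2 <= #|V|.
Proof.
pose bad (p : V * V) := adj G p.1 p.2 && (#|V| < #|side p.1 p.2|.*2).
case: (pickP bad) => [p0 bad0|good]; last first.
  have /card_gt0P[v _] : 0 < #|V| by case: treeG.
  exists v => c cv; rewrite leqNgt; apply/negP => lt.
  by have := good (c, v); rewrite /bad /= cv lt.
case: (arg_minnP (fun p => #|side p.1 p.2|) bad0) => [[z v]] /= /andP[/= zv big] minz.
exists z => c cz; case: (eqVneq c v) => [->|ncv].
  by move: big; rewrite -(card_sideC zv) -!addnn ltn_add2l leq_add2r => /ltnW.
rewrite leqNgt; apply/negP => bigc.
have := minz (c, z); rewrite /bad /= cz bigc => /(_ isT).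
by rewrite leqNgt proper_card // properE side_sub //=; apply/negP => /subsetP/(_ z (side_refl _ _)); apply/negP/side_notin.
Qed.

(* An affine function of the Wiener index, decreasing in it. *)
Definition edge_energy : nat :=
  \sum_x \sum_(y | adj G x y) #|side x y| ^ 2.

(** A crude bound; it only has to stop an ascent in energy. *)
Lemma edge_energy_bound : edge_energy <= #|V| * (#|V| * #|V| ^ 2).
Proof.
rewrite -sum_nat_const; apply: leq_sum => x _.
apply: (@leq_trans (\sum_(y : V) #|V| ^ 2)).
  rewrite [leqRHS](bigID (adj G x)) /= (leq_trans _ (leq_addr _ _)) //.
  by apply: leq_sum => y _; rewrite leq_exp2r // max_card.
by rewrite sum_nat_const.
Qed.

End Sides.

(* With [rho = 1] the tree is rooted at a vertex, its own father; with
   [rho = 2] at an edge, whose ends have level 0 and are each other's father. *)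
Record rooting (V : finType) (G : sgraph V) (rho : nat) (fa : V -> V) (lev : V -> nat)
    : Prop := Rooting {
  rt_adj : forall u v, adj G u v = (u != v) && ((fa u == v) || (fa v == u));
  rt_lev : forall v, lev (fa v) = (lev v).-1;
  rt_root : forall u v, u != v -> lev u = 0 -> lev v = 0 -> fa u = v;
  rt_card : #|[set v | lev v == 0]| = rho;
  rt_gt0 : 0 < rho
}.

Record level_pos (V : finType) (lev pos : V -> nat) : Prop := LevelPos {
  lp_inj : injective pos;
  lp_lt : forall v, pos v < #|V|;
  lp_lev : forall u v, pos u <= pos v -> lev u <= lev v
}.

(** The degree condition of a BFS-ordering is left out: it enters separately, as monotonicity of the
    numbers of children or of the degrees. *)
Record bfs_pos (V : finType) (fa : V -> V) (lev pos : V -> nat) : Prop := BfsPos {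
  bp_level :> level_pos lev pos;
  bp_fa : forall u v, pos u < pos v -> 0 < lev u -> 0 < lev v -> pos (fa u) <= pos (fa v)
}.

(** The condition [0 < lev c] keeps a vertex root from being its own child, and the ends of a root
    edge from being children of each other. *)
Definition children (V : finType) (fa : V -> V) (lev : V -> nat) (v : V) : {set V} :=
  [set c | (0 < lev c) && (fa c == v)].

(** In an ordering compatible with the levels this is also the first position of level [i]. *)
Definition below (V : finType) (lev : V -> nat) (i : nat) := #|[set v | lev v < i]|.

Definition window (V : finType) (lev pos : V -> nat) (i r : nat) : {set V} :=
  [set v | below lev i <= pos v < below lev i + r].

(** * Trees rooted at a vertex or at an edge *)

Section Rooting.
Variables (V : finType) (G : sgraph V) (rho : nat) (fa : V -> V) (lev : V -> nat).
Hypothesis rt : rooting G rho fa lev.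
Implicit Types (u v w c : V).

Local Notation ch := (children fa lev).

Lemma adj_fa v : 0 < lev v -> adj G v (fa v).
Proof.
move=> lv; rewrite (rt_adj rt) eqxx orTb andbT; apply/eqP => E.
by have := rt_lev rt v; rewrite -E; case: (lev v) lv => // n _ /eqP; rewrite /= eqn_leq ltnn.
Qed.

Lemma childrenE v u : (u \in ch v) = adj G v u && (u != fa v).
Proof.
rewrite inE; apply/andP/andP => [[lu /eqP E]|[]].
  rewrite -E adj_sym adj_fa //; split=> //; apply/eqP => E'.
  have := rt_lev rt (fa u); rewrite (rt_lev rt u) -E'.
  by case: (lev u) lu => //= n _; lia.
rewrite (rt_adj rt) => /andP[nvu /orP[/eqP->|/eqP E] nu]; first by rewrite eqxx in nu.
split; last by rewrite E.
rewrite lt0n; apply/negP => /eqP lu; case/eqP: nu.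
by apply/esym/(rt_root rt) => //; rewrite -E (rt_lev rt) lu.
Qed.

Lemma fa_root1 v : rho = 1 -> lev v = 0 -> fa v = v.
Proof.
move=> r1 lv; apply/eqP; have := rt_card rt; rewrite r1 => /eqP/cards1P[x E].
have: v \in [set v | lev v == 0] by rewrite inE lv.
have: fa v \in [set v | lev v == 0] by rewrite inE (rt_lev rt) lv.
by rewrite E !inE => /eqP-> /eqP->.
Qed.

Lemma adj_fa2 v : rho = 2 -> adj G v (fa v).
Proof.
move=> r2; case: (posnP (lev v)) => [lv|]; last exact: adj_fa.
have : 0 < #|[set u | lev u == 0] :\ v|.
  by move: (rt_card rt); rewrite r2 (cardsD1 v) inE lv eqxx add1n => -[->].
case/card_gt0P => u; rewrite !inE => /andP[nuv /eqP lu].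
by rewrite (rt_adj rt) eqxx orTb andbT (rt_root rt (v := u)) // eq_sym.
Qed.

Lemma deg_children v : deg G v = #|ch v| + (v != fa v).
Proof.
rewrite /deg (cardsD1 (fa v)) addnC; congr (_ + _).
  by apply: eq_card => u; rewrite childrenE !inE andbC.
by rewrite inE (rt_adj rt) eqxx orTb andbT.
Qed.

Lemma adj_up u v : adj G v u -> lev u <= lev v -> u = fa v.
Proof.
rewrite (rt_adj rt) => /andP[nvu /orP[/eqP//|/eqP E]] le.
have := rt_lev rt u; rewrite E => lv.
apply/esym/(rt_root rt) => //; lia.
Qed.

Lemma rooting_tree : is_tree G.
Proof.
have conn0 v : exists2 r, lev r = 0 & connect (adj G) v r.
  move: {2}(lev v) (leqnn (lev v)) => n; elim: n v => [|n IH] v lv.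
    by exists v => //; lia.
  case: (posnP (lev v)) => [|lv0]; first by exists v.
  have [|r r0 cr] := IH (fa v); first by rewrite (rt_lev rt); lia.
  by exists r => //; apply: connect_trans (connect1 (adj_fa lv0)) cr.
have csym := sym_connect_sym (adj_sym G).
split.
- by have := rt_gt0 rt; rewrite -(rt_card rt) => /leq_trans -> //; apply: max_card.
- move=> u v; have [r r0 ur] := conn0 u; have [q q0 vq] := conn0 v.
  apply: connect_trans ur _; rewrite csym; apply: connect_trans vq _.
  case: (eqVneq q r) => [->//|nqr]; apply: connect1.
  by rewrite (rt_adj rt) nqr (rt_root rt nqr) // eqxx.
(* A vertex of maximal level on a cycle has its father both before and after it, which leaves room
   for at most two vertices. *)
- move=> c /andP[cyc uc]; rewrite leqNgt; apply/negP => sz.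
  have [x0 x0c] : exists x0, x0 \in c by case: c sz {cyc uc} => // a c; exists a; rewrite mem_head.
  case: (@arg_maxnP _ x0 [in c] lev x0c) => v vc maxv; rewrite /= in vc.
  have nxt : next c v = fa v.
    by apply: adj_up; [apply: next_cycle|apply: maxv; rewrite /= mem_next].
  have prv : prev c v = fa v.
    apply: adj_up; last by apply: maxv; rewrite /= mem_prev.
    by rewrite adj_sym; apply: prev_cycle.
  have: next c (next c v) = v by rewrite nxt -prv next_prev.
  case/rot_to: vc => i s Es.
  rewrite -!(next_rot i uc) Es.
  have: 2 < size (v :: s) by rewrite -Es size_rot.
  have: uniq (v :: s) by rewrite -Es rot_uniq.
  case: s {Es} => [|a [|b s]] //=; rewrite !inE !negb_or => /and3P[/and3P[va vb vs] _ _] _.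
  rewrite !eqxx eq_sym (negbTE va) => E.
  by rewrite E eqxx in vb.
Qed.

End Rooting.

Definition level_set (V : finType) (lev : V -> nat) (i : nat) : {set V} :=
  [set v | lev v == i].

Lemma belowS (V : finType) (lev : V -> nat) i :
  below lev i.+1 = below lev i + #|level_set lev i|.
Proof.
rewrite /below -(cardsID [set v | lev v < i]); congr (_ + _); apply: eq_card => v; rewrite !inE.
  by case: ltngtP => //=; lia.
by rewrite -leqNgt ltnS eqn_leq andbC.
Qed.

Lemma sum_by_level (X : finType) (lx h : X -> nat) (A : {set X}) M :
  (forall x, lx x < M) ->
  \sum_(x in A) h x = \sum_(i < M) \sum_(x in A :&: level_set lx i) h x.
Proof.
move=> lM; rewrite (partition_big (fun x => Ordinal (lM x)) xpredT) //=.
apply: eq_bigr => i _; apply: eq_bigl => x.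
by rewrite !inE.
Qed.

(** * Positions, initial segments and windows of a level *)

Section Positions.
Variables (V : finType) (pos : V -> nat).
Hypotheses (pos_inj : injective pos) (pos_lt : forall v, pos v < #|V|).
Implicit Types (u v w : V) (A : {set V}).

Lemma card_pos_lt b : b <= #|V| -> #|[set v | pos v < b]| = b.
Proof.
move=> bn; pose q v := Ordinal (pos_lt v).
have qi : injective q by move=> u v /(congr1 val)/pos_inj.
have qb : bijective q by apply: inj_card_bij; rewrite ?card_ord.
rewrite (_ : finset _ = q @^-1: [set j : 'I_#|V| | j < b]); last first.
  by apply/setP => v; rewrite !inE.
rewrite on_card_preimset; last exact: onW_bij.
by rewrite -sum1dep_card -(big_ord_widen _ (fun=> 1)) // sum1_card card_ord.
Qed.

Lemma card_pos_interval a r : a + r <= #|V| -> #|[set v | a <= pos v < a + r]| = r.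
Proof.
move=> bn; have := card_pos_lt bn.
rewrite -(cardsID [set v | pos v < a]) (_ : _ :&: _ = [set v | pos v < a]); last first.
  by apply/setP => v; rewrite !inE; lia.
rewrite card_pos_lt ?(leq_trans (leq_addr _ _) bn) // => /addnI {2}<-.
by apply: eq_card => v; rewrite !inE -leqNgt.
Qed.

Lemma pos_onto j : j < #|V| -> exists v, pos v = j.
Proof.
move=> jn; have : 0 < #|[set v | j <= pos v < j + 1]|.
  by rewrite card_pos_interval // addn1.
by case/card_gt0P => v; rewrite inE => E; exists v; lia.
Qed.

Lemma mem_downset A v :
  (forall u w, w \in A -> pos u < pos w -> u \in A) -> (v \in A) = (pos v < #|A|).
Proof.
move=> dA; apply/idP/idP => [vA|].
  rewrite -(card_pos_lt (pos_lt v)) subset_leq_card //; apply/subsetP => u.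
  rewrite inE ltnS leq_eqVlt => /orP[/eqP/pos_inj->//|]; exact: dA.
apply: contraLR => vA; rewrite -leqNgt -[leqRHS](card_pos_lt (ltnW (pos_lt v))).
apply: subset_leq_card; apply/subsetP => w wA; rewrite inE ltnNge leq_eqVlt.
apply: contra vA => /orP[/eqP/pos_inj->//|]; exact: dA.
Qed.

(** For an injective [pos] the sum has at most one term. It reads [f] at a position without an
    inverse of [pos], with the value 0 where there is no vertex. *)
Definition at_pos (f : V -> nat) j := \sum_(v | pos v == j) f v.

Lemma at_posE f v : at_pos f (pos v) = f v.
Proof. by rewrite /at_pos (big_pred1 v) // => u /=; rewrite (inj_eq pos_inj). Qed.

Lemma sum_interval f a r :
  \sum_(v in [set v | a <= pos v < a + r]) f v = \sum_(j < r) at_pos f (a + j).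
Proof.
elim: r => [|r IH].
  by rewrite big_ord0 big1 // => v; rewrite inE; lia.
rewrite big_ord_recr /= -IH (bigID (fun v => pos v < a + r)) /=; congr (_ + _).
  by apply: eq_bigl => v; rewrite !inE; lia.
by apply: eq_bigl => v; rewrite !inE; lia.
Qed.

End Positions.

Section Levels.
Variables (V : finType) (G : sgraph V) (rho : nat) (fa : V -> V) (lev pos : V -> nat).
Hypotheses (rt : rooting G rho fa lev) (lp : level_pos lev pos).
Implicit Types (u v w c : V).

Local Notation ch := (children fa lev).
Local Notation B := (below lev).
Local Notation win := (window lev pos).
Local Notation N i := #|level_set lev i|.
Local Notation E q := (\sum_(v | pos v < q) #|ch v|).

Let pinj := lp_inj lp.
Let plt := lp_lt lp.

Lemma lev_lt_pos i v : (lev v < i) = (pos v < B i).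
Proof.
rewrite /below -(mem_downset pinj plt) ?inE // => u w; rewrite !inE => lw /ltnW/(lp_lev lp); lia.
Qed.

Lemma lev_eq_pos i v : (lev v == i) = (B i <= pos v < B i.+1).
Proof. by rewrite -lev_lt_pos leqNgt -lev_lt_pos; lia. Qed.

Lemma card_children_sum (A : {set V}) :
  #|[set w | (0 < lev w) && (fa w \in A)]| = \sum_(v in A) #|ch v|.
Proof.
rewrite -sum1_card; under [RHS]eq_bigr do rewrite -sum1_card.
rewrite (partition_big fa [in A]) /=; last by move=> w; rewrite inE => /andP[].
by apply: eq_bigr => v vA; apply: eq_bigl => w; rewrite !inE; case: eqP => [->|]; rewrite ?vA ?andbT ?andbF.
Qed.

Lemma below1 : B 1 = rho.
Proof. by rewrite -(rt_card rt); apply: eq_card => v; rewrite !inE ltnS leqn0. Qed.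

(** The non-roots of level at most [i] are the children of the vertices of level less than [i].
    Hence the numbers of children, listed by position, determine the sizes of all levels. *)
Lemma belowS_children i : B i.+1 = rho + E (B i).
Proof.
rewrite -(rt_card rt) /below -(cardsID [set v | lev v == 0]); congr (_ + _).
  by apply: eq_card => v; rewrite !inE; case: eqP => [->|]; rewrite ?andbF.
have := card_children_sum [set v | pos v < B i].
under eq_bigl do rewrite inE; move=> <-.
by apply: eq_card => v; rewrite !inE -lev_lt_pos (rt_lev rt); lia.
Qed.

Lemma window_level i r : r <= N i -> win i r \subset level_set lev i.
Proof.
move=> rN; apply/subsetP => v; rewrite !inE lev_eq_pos belowS; lia.
Qed.

Lemma card_window i r : r <= N i -> #|win i r| = r.
Proof.
move=> rN; apply: (card_pos_interval pinj plt).
apply: (@leq_trans (B i.+1)); first by rewrite belowS leq_add2l.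
by rewrite /below max_card.
Qed.

Lemma window_full i : win i (N i) = level_set lev i.
Proof. by apply/setP => v; rewrite !inE -belowS -lev_eq_pos. Qed.

Lemma window_le i r r' : r <= r' -> win i r \subset win i r'.
Proof. by move=> le; apply/subsetP => v; rewrite !inE; lia. Qed.

Lemma leq_sum_window f i r r' : r <= r' ->
  \sum_(v in win i r) f v <= \sum_(v in win i r') f v.
Proof.
move=> le; rewrite [leqRHS](bigID [in win i r]) /=.
apply: leq_trans (leq_addr _ _); rewrite leq_eqVlt; apply/orP; left; apply/eqP.
apply: eq_bigl => v; apply/idP/andP => [vr|[]//]; split=> //.
by apply: (subsetP (window_le i le)).
Qed.

End Levels.

Section Bfs.
Variables (V : finType) (G : sgraph V) (rho : nat) (fa : V -> V) (lev pos : V -> nat).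
Hypotheses (rt : rooting G rho fa lev) (bp : bfs_pos fa lev pos).

Local Notation ch := (children fa lev).
Local Notation B := (below lev).
Local Notation win := (window lev pos).
Local Notation E q := (\sum_(v | pos v < q) #|ch v|).

(** The roots and the children of an initial segment form an initial segment again, which is known
    from its cardinality. *)
Lemma fa_lt_pos q w : 0 < lev w -> (pos (fa w) < q) = (pos w < rho + E q).
Proof.
move=> lw.
pose A := [set w | (lev w == 0) || ((0 < lev w) && (pos (fa w) < q))].
have -> : rho + E q = #|A|.
  rewrite -(rt_card rt) -(cardsID [set v | lev v == 0] A) /A; congr (_ + _).
    by apply: eq_card => v; rewrite !inE; case: (lev v == 0); rewrite ?andbF.
  have := (card_children_sum fa lev) [set v | pos v < q].
  under eq_bigl do rewrite inE; move=> <-.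
  by apply: eq_card => v; rewrite !inE; case: posnP.
rewrite -(mem_downset (lp_inj bp) (lp_lt bp)) => [|u v]; first by rewrite inE lw; case: posnP lw.
rewrite !inE; case: (posnP (lev u)) => //= lu; case: (posnP (lev v)) => [lv _ puv|lv /=].
  by have := lp_lev bp (ltnW puv); lia.
by move=> pv puv; have := bp_fa bp puv lu lv; lia.
Qed.

Lemma window_children i r :
  [set w | (0 < lev w) && (fa w \in win i r)]
  = win i.+1 (\sum_(v in win i r) #|ch v|).
Proof.
apply/setP => w; rewrite !inE (belowS_children rt bp) -addnA.
have -> : E (B i) + \sum_(v in win i r) #|ch v| = E (B i + r).
  rewrite [RHS](bigID (fun v => pos v < B i)) /=; congr (_ + _).
    by apply: eq_bigl => v; lia.
  by apply: eq_bigl => v; rewrite !inE; lia.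
case: (posnP (lev w)) => [lw|lw] /=; last first.
  by rewrite -(fa_lt_pos (B i + r) lw) [in RHS]leqNgt -(fa_lt_pos (B i) lw) -leqNgt.
have: pos w < B 1 by rewrite -(lev_lt_pos bp) lw.
by rewrite (below1 rt); lia.
Qed.

End Bfs.

(** * Inequalities between sums over sets and over prefixes *)

(** The maximum of [f] on [B] separates the two families of values. *)
Lemma leq_sum_cross (T : finType) (f : T -> nat) (A B : {set T}) :
  #|B| <= #|A| -> (forall a b, a \in A -> b \in B -> f b <= f a) ->
  \sum_(b in B) f b <= \sum_(a in A) f a.
Proof.
move=> BA le; apply: (@leq_trans (#|B| * \max_(b in B) f b)).
  by rewrite -sum_nat_const; apply: leq_sum => b bB; apply: leq_bigmax_cond.
apply: (@leq_trans (#|A| * \max_(b in B) f b)); first by rewrite leq_mul2r BA orbT.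
rewrite -sum_nat_const; apply: leq_sum => a aA; apply/bigmax_leqP => b; exact: le.
Qed.

Lemma leq_sum_top (T : finType) (f : T -> nat) (A B : {set T}) :
  #|B| = #|A| -> (forall a b, a \in A -> b \in B -> b \notin A -> f b <= f a) ->
  \sum_(b in B) f b <= \sum_(a in A) f a.
Proof.
move=> BA le; rewrite [leqLHS](big_setID A) [leqRHS](big_setID B) /= setIC leq_add2l.
apply: leq_sum_cross.
  by rewrite -(leq_add2l #|A :&: B|) cardsID setIC cardsID BA.
by move=> a b; rewrite !inE => /andP[_ aA] /andP[bA bB]; apply: le.
Qed.

(** Abel summation: subtracting the last weight from all others keeps them nonincreasing and
    shortens the sum by one term; what is split off is a multiple of a full prefix sum. *)
Lemma abel_leq (x y w : nat -> nat) r :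
  (forall t, t <= r -> \sum_(j < t) x j <= \sum_(j < t) y j) ->
  (forall i j, i < j -> j < r -> w j <= w i) ->
  \sum_(j < r) w j * x j <= \sum_(j < r) w j * y j.
Proof.
elim: r w => [|r IH] w le dw; first by rewrite !big_ord0.
have split (z : nat -> nat) : \sum_(j < r.+1) w j * z j
    = \sum_(j < r) (w j - w r) * z j + w r * \sum_(j < r.+1) z j.
  rewrite !big_ord_recr /= mulnDr addnA; congr (_ + _).
  rewrite big_distrr /= -big_split /=; apply: eq_bigr => j _.
  by rewrite -mulnDl subnK // dw.
rewrite !split; apply: leq_add; last by rewrite leq_mul2l le ?orbT.
apply: (IH (fun j => w j - w r)) => [t tr|i j ij jr]; first by apply: le; apply: leqW.
by apply: leq_sub2r; apply: dw => //; apply: leqW.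
Qed.

Lemma sort_desc_nth (T : eqType) (f : T -> nat) x0 (s : seq T) a b :
  a < b -> b < size (sort (fun u v => f v <= f u) s) ->
  f (nth x0 (sort (fun u v => f v <= f u) s) b)
    <= f (nth x0 (sort (fun u v => f v <= f u) s) a).
Proof.
move=> ab bs; set l := sort _ s in bs *.
have tr : transitive (fun u v => f v <= f u) by move=> u v w h1 h2; apply: leq_trans h2 h1.
have so : sorted (fun u v => f v <= f u) l by apply: sort_sorted => u v; apply: leq_total.
by apply: (sorted_ltn_nth tr x0 so); rewrite ?inE // (ltn_trans ab).
Qed.

Lemma exchange_set (T : finType) (f : T -> nat) (A : {set T}) a b : a \in A -> b \notin A ->
  #|b |: A :\ a| = #|A| /\
  (\sum_(v in b |: A :\ a) f v <= \sum_(v in A) f v -> f b <= f a).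
Proof.
move=> aA bA; have bAa : b \notin A :\ a by rewrite inE negb_and bA orbT.
split; first by rewrite cardsU1 bAa [RHS](cardsD1 a) aA.
by rewrite big_setU1 //= (big_setD1 a aA) /= leq_add2r.
Qed.

Lemma sum_children_set (X : finType) (fx : X -> X) (lx h : X -> nat) (A : {set X}) :
  \sum_(v in A) \sum_(c in children fx lx v) h c
  = \sum_(c in [set c | (0 < lx c) && (fx c \in A)]) h c.
Proof.
rewrite [RHS](partition_big fx [in A]) => [|c]; last by rewrite inE => /andP[].
apply: eq_bigr => v vA; apply: eq_bigl => c; rewrite !inE.
by case: eqP => [->|]; rewrite ?vA ?andbT ?andbF.
Qed.

(** * Recursions along a rooting, and comparison of branches within one tree *)

Section Monotone.
Variables (V : finType) (G : sgraph V) (rho : nat) (fa : V -> V) (lev : V -> nat).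
Hypothesis rt : rooting G rho fa lev.
Implicit Types (u v w c : V).
Local Notation ch := (children fa lev).

Let treeG := rooting_tree rt.

Lemma swalks_children v k : swalks G v (fa v) k = \sum_(c in ch v) dwalks G c (fa c) k.
Proof.
rewrite /swalks; apply: eq_big => c; first by rewrite (childrenE rt).
by rewrite -(childrenE rt) inE => /andP[_ /eqP->].
Qed.

Lemma card_side_children v :
  #|side G v (fa v)| = (\sum_(c in ch v) #|side G c (fa c)|).+1.
Proof.
rewrite card_side //; congr _.+1; apply: eq_big => c; first by rewrite (childrenE rt).
by rewrite -(childrenE rt) inE => /andP[_ /eqP->].
Qed.

Lemma cwalks_nonroot v k : 0 < lev v -> cwalks G v k.+1 =
  conv (swalks G v (fa v)) (cwalks G v) k + conv (dwalks G v (fa v)) (cwalks G (fa v)) k.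
Proof. by move=> /(adj_fa rt) av; rewrite (cwalksS treeG _ av) nwalksT_side. Qed.

Lemma cwalks_root1 v k : rho = 1 -> lev v = 0 ->
  cwalks G v k.+1 = conv (swalks G v (fa v)) (cwalks G v) k.
Proof.
move=> r1 lv; rewrite (fa_root1 rt r1 lv) -dwalksxx // dwalksS //.
by apply: eq_conv => // a; rewrite dwalksxx.
Qed.

Definition rwalks v k := nwalks G setT k v (fa v).

Lemma cwalks_root2 v k : rho = 2 ->
  cwalks G v k.+1 = conv (swalks G v (fa v)) (cwalks G v) k + rwalks v k.
Proof. by move=> r2; rewrite (cwalksS treeG _ (adj_fa2 rt v r2)). Qed.

Lemma rwalks0 v : rho = 2 -> rwalks v 0 = 0.
Proof. by move=> r2; rewrite /rwalks /= (negbTE (adj_neq (adj_fa2 rt v r2))) andbF. Qed.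

Lemma rwalksS v k : rho = 2 ->
  rwalks v k.+1 = conv (swalks G v (fa v)) (rwalks v) k + cwalks G (fa v) k.
Proof. by move=> r2; rewrite /rwalks nwalksT_adjS // (adj_fa2 rt v r2). Qed.

Lemma fa_root2 u v : lev u = 0 -> lev v = 0 -> u != v -> fa u = v /\ fa v = u.
Proof. by move=> lu lv nuv; split; apply: (rt_root rt); rewrite // eq_sym. Qed.

Lemma rwalks_root u v k : lev u = 0 -> lev v = 0 -> rwalks u k = rwalks v k.
Proof.
move=> lu lv; case: (eqVneq u v) => [->//|nuv].
by rewrite /rwalks; have [-> ->] := fa_root2 lu lv nuv; apply: nwalks_sym.
Qed.

Lemma sum_roots_fa (f : V -> nat) : rho = 2 ->
  \sum_(v in level_set lev 0) f (fa v) = \sum_(v in level_set lev 0) f v.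
Proof.
move=> r2; have [x lx] : exists x, lev x = 0.
  have : 0 < #|[set v | lev v == 0]| by rewrite (rt_card rt) r2.
  by case/card_gt0P => x; rewrite inE => /eqP; exists x.
have nx := adj_neq (adj_fa2 rt x r2).
have lfx : lev (fa x) = 0 by rewrite (rt_lev rt) lx.
have -> : level_set lev 0 = [set x; fa x].
  apply/eqP; rewrite eq_sym eqEcard cards2 nx (rt_card rt) r2 leqnn andbT.
  by apply/subsetP => v; rewrite !inE => /orP[] /eqP->; rewrite ?lx ?lfx.
rewrite !big_setU1 ?inE //= !big_set1 addnC.
by have [_ ->] := fa_root2 lx lfx nx.
Qed.

(** The relation is abstract because it has two instances: the order of positions inside a level,
    for level by level comparisons, and the order of all positions, for a tree whose degrees
    decrease along it. *)
Variable better : V -> V -> Prop.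
Hypothesis better_card : forall u v, better u v -> #|ch v| <= #|ch u|.
Hypothesis better_ch : forall u v a b, better u v -> a \in ch u -> b \in ch v -> better a b.

Lemma dwalks_better k u v : better u v -> dwalks G v (fa v) k <= dwalks G u (fa u) k.
Proof.
elim/ltn_ind: k u v => -[|k] IH u v uv; first by rewrite !dwalks0.
rewrite !dwalksS //; apply: leq_conv => a ak; last by apply: IH (leqW ak) _ _ uv.
rewrite !swalks_children; apply: leq_sum_cross; first exact: better_card uv.
by move=> c d cu dv; apply: IH; [apply: leqW|apply: better_ch uv cu dv].
Qed.

Lemma swalks_better k u v : better u v -> swalks G v (fa v) k <= swalks G u (fa u) k.
Proof.
move=> uv; rewrite !swalks_children; apply: leq_sum_cross; first exact: better_card uv.
by move=> c d cu dv; apply: dwalks_better; apply: better_ch uv cu dv.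
Qed.

Lemma card_side_better u v : better u v -> #|side G v (fa v)| <= #|side G u (fa u)|.
Proof.
move: {2}(#|_|) (leqnn #|side G v (fa v)|) => n; elim: n u v => [|n IH] u v.
  by rewrite card_side_children.
rewrite !card_side_children ltnS => le uv; rewrite ltnS.
apply: leq_sum_cross; first exact: better_card uv.
move=> c d cu dv; apply: IH; last exact: better_ch uv cu dv.
by apply: leq_trans le; rewrite (bigD1 d) //= leq_addr.
Qed.

End Monotone.

(** * Majorization, level by level, of one rooted tree by another *)

Section Compare.
Variables (V : finType) (G : sgraph V) (rho : nat) (fa : V -> V) (lev : V -> nat).
Variables (W : finType) (H : sgraph W) (fa' : W -> W) (lev' pos : W -> nat).
Hypotheses (rt : rooting G rho fa lev) (rt' : rooting H rho fa' lev').
Hypothesis bp : bfs_pos fa' lev' pos.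
Hypothesis same_levels : forall i, #|level_set lev i| = #|level_set lev' i|.

Local Notation ch := (children fa lev).
Local Notation ch' := (children fa' lev').
Local Notation win := (window lev' pos).
Local Notation B := (below lev').
Local Notation L := (level_set lev).
Local Notation L' := (level_set lev').

Let pinj := lp_inj bp.
Let plt := lp_lt bp.

(** If [g] decreases along the positions of level [i], this is weak majorization on that level.
    Quantifying over subsets spares a sorting of [f]. *)
Definition dom i (f : V -> nat) (g : W -> nat) : Prop :=
  forall s : {set V}, s \subset L i -> \sum_(v in s) f v <= \sum_(w in win i #|s|) g w.

Definition desc i (g : W -> nat) : Prop :=
  forall u v, lev' u = i -> lev' v = i -> pos u < pos v -> g v <= g u.

Lemma card_sub_level i (s : {set V}) : s \subset L i -> #|s| <= #|L' i|.
Proof. by rewrite -same_levels; apply: subset_leq_card. Qed.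

Lemma dom_le i f g :
  (forall v w, lev v = i -> lev' w = i -> f v <= g w) -> dom i f g.
Proof.
move=> fg s sL; pose c := \max_(v in L i) f v.
apply: (@leq_trans (#|s| * c)).
  rewrite -sum_nat_const; apply: leq_sum => v vs.
  by apply: leq_bigmax_cond; apply: (subsetP sL).
have sN := card_sub_level sL.
rewrite -{1}(card_window bp sN) -sum_nat_const; apply: leq_sum => w ws.
apply/bigmax_leqP => v; rewrite inE => /eqP lv; apply: fg lv _.
by have := subsetP (window_level bp sN) w ws; rewrite inE => /eqP.
Qed.

Lemma dom_eq i f f' g g' :
  (forall v, lev v = i -> f v = f' v) -> (forall w, lev' w = i -> g w = g' w) ->
  dom i f g -> dom i f' g'.
Proof.
move=> ef eg d s sL; have sN := card_sub_level sL.
rewrite (eq_bigr f) => [|v vs]; last first.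
  by rewrite -ef //; have := subsetP sL v vs; rewrite inE => /eqP.
rewrite (eq_bigr g) => [|w ws]; first exact: d.
by rewrite -eg //; have := subsetP (window_level bp sN) w ws; rewrite inE => /eqP.
Qed.

Lemma dom_sum (I : Type) (r : seq I) (P : pred I) i f g :
  (forall a, P a -> dom i (f a) (g a)) ->
  dom i (fun v => \sum_(a <- r | P a) f a v) (fun w => \sum_(a <- r | P a) g a w).
Proof.
by move=> d s sL; rewrite exchange_big [leqRHS]exchange_big /=; apply: leq_sum => a /d; apply.
Qed.

Lemma dom_add i f f' g g' : dom i f g -> dom i f' g' ->
  dom i (fun v => f v + f' v) (fun w => g w + g' w).
Proof. by move=> d d' s sL; rewrite !big_split /=; apply: leq_add; [apply: d|apply: d']. Qed.

Lemma dom_prefix i f g x0 (l : seq V) t : dom i f g -> uniq l -> {subset l <= L i} ->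
  t <= size l ->
  \sum_(j < t) f (nth x0 l j) <= \sum_(j < t) at_pos pos g (B i + j).
Proof.
move=> d ul lL ts; rewrite -(sum_interval pos g).
have E : #|[set v in take t l]| = t.
  by rewrite cardsE (card_uniqP _) ?take_uniq // size_takel.
have sub : [set v in take t l] \subset L i.
  by apply/subsetP => v; rewrite inE => /mem_take/lL.
have := d _ sub; rewrite E; apply: leq_trans.
rewrite (eq_bigl [in take t l]) => [|v]; last by rewrite inE.
rewrite -big_uniq ?take_uniq //= (big_nth x0) size_takel // big_mkord.
by apply: leq_sum => j _; rewrite nth_take.
Qed.

Lemma level_index i j : j < #|L' i| -> exists2 w, pos w = B i + j & lev' w = i.
Proof.
move=> jN; have bj : B i + j < #|W|.
  apply: (@leq_trans (B i.+1)); last exact: max_card.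
  by rewrite belowS ltn_add2l.
have [w pw] := pos_onto pinj plt bj; exists w => //; apply/eqP.
by rewrite (lev_eq_pos bp) pw belowS; lia.
Qed.

Lemma desc_at_pos i g a b : desc i g -> a < b -> b < #|L' i| ->
  at_pos pos g (B i + b) <= at_pos pos g (B i + a).
Proof.
move=> dg ab bN; have [v pv lv] := level_index bN.
have [u pu lu] := level_index (ltn_trans ab bN).
by rewrite -pv -pu !at_posE //; apply: dg => //; lia.
Qed.

(** Two Abel summations: with [s] sorted by [f'], the weights [f'] allow [f] to be replaced by [g];
    then the weights [g], which decrease along the positions, allow [f'] to be replaced by [g']. *)
Lemma dom_mul i f f' g g' : desc i g -> desc i g' -> dom i f g -> dom i f' g' ->
  dom i (fun v => f v * f' v) (fun w => g w * g' w).
Proof.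
move=> sg sg' d d' s sL; have sN := card_sub_level sL.
have [-> | [x0 x0s]] := set_0Vmem s; first by rewrite big_set0.
pose l := sort (fun u v => f' v <= f' u) (enum s).
have lp : perm_eq l (enum s) by rewrite perm_sort.
have ls : size l = #|s| by rewrite (perm_size lp) cardE.
have ul : uniq l by rewrite (perm_uniq lp) enum_uniq.
have lL : {subset l <= L i}.
  by move=> v; rewrite (perm_mem lp) mem_enum; apply: (subsetP sL).
pose x j := f (nth x0 l j); pose x' j := f' (nth x0 l j).
pose y j := at_pos pos g (B i + j); pose y' j := at_pos pos g' (B i + j).
apply: (@leq_trans (\sum_(j < #|s|) x' j * x j)).
  rewrite -big_enum /= -(perm_big _ lp) (big_nth x0) ls big_mkord.
  by apply: leq_sum => j _; rewrite mulnC.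
apply: (@leq_trans (\sum_(j < #|s|) x' j * y j)).
  apply: abel_leq => [t ts|a b ab bs]; first by apply: dom_prefix; rewrite ?ls.
  by apply: sort_desc_nth; rewrite ?ls.
rewrite (sum_interval pos (fun w => g w * g' w)).
apply: (@leq_trans (\sum_(j < #|s|) y j * y' j)).
  under eq_bigr do rewrite mulnC.
  apply: abel_leq => [t ts|a b ab bs]; first by apply: dom_prefix; rewrite ?ls.
  exact: desc_at_pos sg ab (leq_trans bs sN).
apply: leq_sum => j _; rewrite /y /y'.
by have [v <- _] := level_index (leq_trans (ltn_ord j) sN); rewrite !at_posE.
Qed.

(* Writing x and y for the two sequences, the inequalities
   sum x^2 <= sum x y <= sum y^2 force x = y when the extreme terms agree. *)
Lemma dom_square_eq i f g (U : {set V}) : desc i g -> dom i f g ->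
  \sum_(w in L' i) g w ^ 2 <= \sum_(v in L i) f v ^ 2 ->
  U \subset L i -> (forall u v, u \in U -> v \in L i -> v \notin U -> f v <= f u) ->
  \sum_(v in U) f v = \sum_(w in win i #|U|) g w.
Proof.
move=> sg d sq UL top.
have [U0 | [x0 x0U]] := set_0Vmem U.
  by rewrite U0 big_set0 cards0 big1 // => w; rewrite inE; lia.
pose srt (A : {set V}) := sort (fun u v => f v <= f u) (enum A).
have srtp A : perm_eq (srt A) (enum A) by rewrite perm_sort.
have mem_srt A v : (v \in srt A) = (v \in A) by rewrite (perm_mem (srtp A)) mem_enum.
have size_srt A : size (srt A) = #|A| by rewrite (perm_size (srtp A)) cardE.
pose l := srt U ++ srt (L i :\: U).
have LU : #|L i| = #|U| + #|L i :\: U| by rewrite -(cardsID U (L i)) (setIidPr UL).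
have ls : size l = #|L i| by rewrite size_cat !size_srt LU.
have lL : {subset l <= L i}.
  move=> v; rewrite mem_cat !mem_srt in_setD => /orP[|/andP[]//]; exact: (subsetP UL).
have ul : uniq l.
  rewrite cat_uniq !(perm_uniq (srtp _)) !enum_uniq andbT /=.
  by apply/hasPn => v; rewrite !mem_srt in_setD => /andP[].
have lperm : perm_eq l (enum (L i)).
  apply: uniq_perm; rewrite ?enum_uniq // => v.
  rewrite mem_enum mem_cat !mem_srt in_setD.
  by case: (boolP (v \in U)) => // /(subsetP UL)->.
pose x j := f (nth x0 l j); pose y j := at_pos pos g (B i + j).
have sumx h : \sum_(v in L i) h v = \sum_(j < #|L i|) h (nth x0 l j).
  by rewrite -big_enum /= -(perm_big _ lperm) (big_nth x0) ls big_mkord.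
have dx a b : a < b -> b < #|L i| -> x b <= x a.
  move=> ab bs; rewrite /x !nth_cat size_srt.
  case: (ltnP a #|U|) => aU; case: (ltnP b #|U|) => bU.
  - by apply: sort_desc_nth; rewrite ?size_srt.
  - have vS : nth x0 (srt (L i :\: U)) (b - #|U|) \in L i :\: U.
      by rewrite -mem_srt mem_nth // size_srt; lia.
    by move: vS; rewrite inE => /andP[vU vL]; apply: top; rewrite // -mem_srt mem_nth ?size_srt.
  - by have := leq_ltn_trans aU (ltn_trans ab bU); rewrite ltnn.
  - apply: sort_desc_nth; first by lia.
    by rewrite -/(srt _) size_srt; lia.
have pre t : t <= #|L i| -> \sum_(j < t) x j <= \sum_(j < t) y j.
  by move=> tL; apply: dom_prefix; rewrite ?ls.
have xy : \sum_(j < #|L i|) x j * x j <= \sum_(j < #|L i|) x j * y j by apply: abel_leq.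
have yx : \sum_(j < #|L i|) y j ^ 2 <= \sum_(j < #|L i|) x j ^ 2.
  rewrite -(sumx (fun v => f v ^ 2)); apply: leq_trans sq.
  rewrite -(window_full bp) -same_levels (sum_interval pos (fun w => g w ^ 2)).
  apply: leq_sum => j _; have jN := ltn_ord j; rewrite [X in _ < X]same_levels in jN.
  by rewrite /y; have [w <- _] := level_index jN; rewrite !at_posE.
have /leqifP := leqif_sum (fun (j : 'I_#|L i|) (_ : true) => nat_Cauchy (x j) (y j)).
case: ifP => [/forallP eqxy _|_]; last first.
  rewrite -big_distrr big_split /= ltnNge => /negP[].
  rewrite mul2n -addnn; apply: leq_add; last apply: (leq_trans yx);
  by apply: leq_trans xy; apply: leq_sum => j _; rewrite mulnn.
have UN : #|U| <= #|L i| by apply: subset_leq_card.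
rewrite (sum_interval pos g) -big_enum /= -(perm_big _ (srtp U)) (big_nth x0) size_srt big_mkord.
apply: eq_bigr => j _; have /eqP := eqxy (widen_ord UN j).
by rewrite /= /x nth_cat size_srt ltn_ord.
Qed.

Lemma dom_conv i k (f f' : V -> nat -> nat) (g g' : W -> nat -> nat) :
  (forall a, a < k -> [/\ desc i (g^~ a), desc i (g'^~ a), dom i (f^~ a) (g^~ a)
     & dom i (f'^~ a) (g'^~ a)]) ->
  dom i (fun v => conv (f v) (f' v) k) (fun w => conv (g w) (g' w) k).
Proof.
move=> d; apply: dom_sum => a _.
have [dg _ dfg _] := d a (ltn_ord a).
have [|_ dg' _ dfg'] := d (k.-1 - a); first by have := ltn_ord a; lia.
exact: dom_mul.
Qed.

Hypothesis dom_card : forall i, dom i (fun v => #|ch v|) (fun w => #|ch' w|).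

(** The children of [s] are at most as many as those of the first [#|s|] vertices, and the latter
    fill an initial window of the next level. *)
Lemma dom_children i f g : dom i.+1 f g ->
  dom i (fun v => \sum_(c in ch v) f c) (fun w => \sum_(c in ch' w) g c).
Proof.
move=> d s sL.
rewrite !sum_children_set (window_children rt' bp).
apply: leq_trans (d _ _) _.
  apply/subsetP => c; rewrite !inE => /andP[lc /(subsetP sL)].
  by rewrite inE (rt_lev rt) => /eqP<-; rewrite prednK.
apply: leq_sum_window; rewrite card_children_sum; exact: dom_card.
Qed.

Lemma sum_fathers (X : finType) (fx : X -> X) (lx h : X -> nat) (S A : {set X}) :
  (forall c, c \in S -> 0 < lx c) ->
  \sum_(v in A) #|children fx lx v :&: S| * h v
  = \sum_(c in S | fx c \in A) h (fx c).
Proof.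
move=> lS; rewrite [RHS](partition_big fx [in A]) => [|c /andP[]//].
apply: eq_bigr => v vA; rewrite (eq_bigr (fun=> h v)) => [|c /andP[_ /eqP->]//].
rewrite -sum_nat_const; apply: eq_bigl => c; rewrite !inE.
case: (boolP (c \in S)) => [/lS->|_]; rewrite ?andbF //= andbT.
by case: eqP => [->|]; rewrite ?vA ?andbF.
Qed.

Hypothesis desc_card : forall i, desc i (fun w => #|ch' w|).

Definition earlier (u v : W) : Prop := lev' u = lev' v /\ pos u < pos v.

Lemma earlier_card u v : earlier u v -> #|ch' v| <= #|ch' u|.
Proof. by move=> [luv puv]; apply: (desc_card (i := lev' v)). Qed.

Lemma earlier_children u v a b : earlier u v -> a \in ch' u -> b \in ch' v -> earlier a b.
Proof.
move=> [luv puv]; rewrite !inE => /andP[la /eqP fa_a] /andP[lb /eqP fa_b]; split.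
  by have := rt_lev rt' a; have := rt_lev rt' b; rewrite fa_a fa_b; lia.
rewrite ltnNge leq_eqVlt; apply/negP => /orP[/eqP/pinj E|ba].
  by rewrite -fa_a -fa_b E ltnn in puv.
by have := bp_fa bp ba lb la; rewrite fa_a fa_b leqNgt puv.
Qed.

(** This controls the walks that leave a branch, as they continue from the father. Grouped by
    fathers, the sum is that of [m u * f u], with [m u] the number of chosen children of [u]. Since
    [m] is majorized by its counterpart [m'] for the window, [dom_mul] applies to the whole level
    [i]. *)
Lemma dom_father i f g : desc i g -> dom i f g ->
  dom i.+1 (fun v => f (fa v)) (fun w => g (fa' w)).
Proof.
move=> dg d s sL; have sN := card_sub_level sL.
have wL := window_level bp sN.
have ls c : c \in s -> 0 < lev c by move/(subsetP sL); rewrite inE => /eqP->.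
have lw c : c \in win i.+1 #|s| -> 0 < lev' c by move/(subsetP wL); rewrite inE => /eqP->.
pose m u := #|ch u :&: s|; pose m' u := #|ch' u :&: win i.+1 #|s| |.
(* As soon as a later vertex has a child in the window, all children of an earlier one are in it. *)
have dm' : desc i m'.
  move=> u v lu lv uv; have e : earlier u v by split; rewrite ?lu.
  rewrite /m'; have [->|[b]] := set_0Vmem (ch' v :&: win i.+1 #|s|); first by rewrite cards0.
  rewrite in_setI => /andP[bv bw]; apply: leq_trans (subset_leq_card (subsetIl _ _)) _.
  apply: leq_trans (earlier_card e) _; apply: subset_leq_card.
  apply/subsetP => a au; rewrite in_setI au /=.
  have [lab pab] := earlier_children e au bv.
  have la : lev' a == i.+1 by move/(subsetP wL): bw; rewrite inE -lab.
  by move: la bw; rewrite (lev_eq_pos bp) !inE; lia.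
have dm : dom i m m'.
  move=> t tL; have tN := card_sub_level tL.
  have sumE (X : finType) (fx : X -> X) (lx : X -> nat) (S A : {set X}) :
      (forall c, c \in S -> 0 < lx c) ->
      \sum_(v in A) #|children fx lx v :&: S| = #|[set c in S | fx c \in A]|.
    move=> lS; have := sum_fathers fx (fun=> 1) A lS; rewrite sum1dep_card => <-.
    by apply: eq_bigr => v _; rewrite muln1.
  rewrite !sumE //; set e := \sum_(v in win i #|t|) #|ch' v|.
  (* Both the window and the set of children of the first [#|t|] vertices are initial segments of
     the level, so they meet in the shorter one. *)
  have -> : [set c in win i.+1 #|s| | fa' c \in win i #|t|] = win i.+1 (minn #|s| e).
    apply/setP => c; have := window_children rt' bp i #|t| => /setP/(_ c).
    rewrite [c \in [set _ in _ | _]]inE; case: (boolP (c \in win i.+1 #|s|)) => cs.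
      rewrite inE (lw _ cs) /= => ->; move: cs; rewrite !inE -/e; lia.
    by move=> _; move: cs; rewrite !inE; lia.
  rewrite (card_window bp) ?(leq_trans (geq_minl _ _)) // leq_min; apply/andP; split.
    by apply: subset_leq_card; apply/subsetP => c; rewrite inE => /andP[].
  apply: leq_trans (dom_card tL); rewrite -card_children_sum.
  by apply: subset_leq_card; apply/subsetP => c; rewrite !inE => /andP[/ls-> ->].
have := dom_mul dm' dg dm d (subxx (L i)).
rewrite same_levels (window_full bp) !sum_fathers //.
have inL (X : finType) (fx : X -> X) (lx : X -> nat) (h : X -> nat) (S : {set X}) :
    (forall c, lx (fx c) = (lx c).-1) -> S \subset level_set lx i.+1 ->
    \sum_(c in S | fx c \in level_set lx i) h (fx c) = \sum_(c in S) h (fx c).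
  move=> lf SL; apply: eq_bigl => c; case: (boolP (c \in S)) => //= /(subsetP SL).
  by rewrite !inE lf => /eqP->; rewrite eqxx.
by rewrite !inL //; [apply: rt_lev rt'|apply: rt_lev rt].
Qed.

Let treeG := rooting_tree rt.
Let treeH := rooting_tree rt'.

Lemma desc_dwalks k i : desc i (fun w => dwalks H w (fa' w) k).
Proof.
move=> u v lu lv uv.
by apply: (dwalks_better rt' earlier_card earlier_children); split; rewrite ?lu.
Qed.

Lemma desc_swalks k i : desc i (fun w => swalks H w (fa' w) k).
Proof.
move=> u v lu lv uv.
by apply: (swalks_better rt' earlier_card earlier_children); split; rewrite ?lu.
Qed.

Lemma desc_card_side i : desc i (fun w => #|side H w (fa' w)|).
Proof.
move=> u v lu lv uv.
by apply: (card_side_better rt' earlier_card earlier_children); split; rewrite ?lu.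
Qed.

Lemma dom_swalks_of k : (forall i, dom i (fun v => dwalks G v (fa v) k)
    (fun w => dwalks H w (fa' w) k)) ->
  forall i, dom i (fun v => swalks G v (fa v) k) (fun w => swalks H w (fa' w) k).
Proof.
move=> d i; apply: dom_eq (dom_children (d i.+1)) => x _; by rewrite (swalks_children rt, swalks_children rt').
Qed.

Lemma dom_dwalks k i : dom i (fun v => dwalks G v (fa v) k) (fun w => dwalks H w (fa' w) k).
Proof.
elim/ltn_ind: k i => -[|k] IH i; first by apply: dom_le => v w _ _; rewrite !dwalks0.
apply: (dom_eq (f := fun v => conv (swalks G v (fa v)) (dwalks G v (fa v)) k)
               (g := fun w => conv (swalks H w (fa' w)) (dwalks H w (fa' w)) k));
  [by move=> x _; rewrite dwalksS..|].
apply: dom_conv => a ak; split; [exact: desc_swalks|exact: desc_dwalks| |by apply: IH; apply: leqW].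
by apply: dom_swalks_of => j; apply: IH; apply: leqW.
Qed.

Lemma dom_swalks k i : dom i (fun v => swalks G v (fa v) k) (fun w => swalks H w (fa' w) k).
Proof. exact/dom_swalks_of/dom_dwalks. Qed.

(** Induction from the deepest level upwards: a branch has one vertex more than the branches of the
    children together. *)
Lemma dom_card_side i : dom i (fun v => #|side G v (fa v)|) (fun w => #|side H w (fa' w)|).
Proof.
have [M MP] : exists M, forall v, lev v < M.
  by exists (\max_v lev v).+1 => v; rewrite ltnS; apply: leq_bigmax.
move: {2}(M - i) (leqnn (M - i)) => n; elim: n i => [|n IH] i Mi.
  by apply: dom_le => v w lv; have := MP v; lia.
apply: dom_eq (dom_add (dom_le (i := i) (f := fun=> 1) (g := fun=> 1) _) (dom_children (IH i.+1 _))).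
- by move=> v _; rewrite (card_side_children rt).
- by move=> v _; rewrite (card_side_children rt').
- by [].
- by lia.
Qed.

Hypothesis rho_le2 : rho <= 2.

Let rho_cases : rho = 1 \/ rho = 2.
Proof. by move: (rt_gt0 rt) rho_le2; case: rho => [|[|[]]] //; [left|right]. Qed.

Lemma desc_cwalks k i : desc i (fun w => cwalks H w k).
Proof.
elim/ltn_ind: k i => -[|k] IH i u v lu lv puv; first by rewrite !cwalks0.
have convS : conv (swalks H v (fa' v)) (cwalks H v) k <= conv (swalks H u (fa' u)) (cwalks H u) k.
  by apply: leq_conv => a ak; [apply: (desc_swalks _ lu lv)|apply: (IH _ (leqW ak) _ _ _ lu lv)].
case: (posnP i) => i0.
  case: rho_cases => r; first by rewrite !(cwalks_root1 rt') // ?lu ?lv.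
  by rewrite !(cwalks_root2 rt') // (@rwalks_root _ _ _ _ _ rt' u v) ?lu ?lv // leq_add2r.
rewrite !(cwalks_nonroot rt') ?lu ?lv //; apply: leq_add => //.
apply: leq_conv => a ak; first exact: (desc_dwalks _ lu lv).
have: pos (fa' u) <= pos (fa' v) by apply: (bp_fa bp puv); rewrite ?lu ?lv.
rewrite leq_eqVlt => /orP[/eqP/pinj->//|].
by apply: (IH _ (leqW ak) i.-1); rewrite (rt_lev rt') ?lu ?lv.
Qed.

(* At an edge-root the number r_k of walks between the two ends satisfies
   2 r_(k+1) = sum over both ends of S * r + C_k, so that it is controlled by
   the sum of the C_k although r_(k+1) only involves one of them. *)
Lemma dom_cwalks_rwalks k : (forall i, dom i (fun v => cwalks G v k) (fun w => cwalks H w k)) /\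
  (rho = 2 -> forall v w, lev v = 0 -> lev' w = 0 -> rwalks G fa v k <= rwalks H fa' w k).
Proof.
elim/ltn_ind: k => -[|k] IH.
  split; first by move=> i; apply: dom_le => v w _ _; rewrite !cwalks0.
  by move=> r2 v w _ _; rewrite (rwalks0 rt).
have domSC i : dom i (fun v => conv (swalks G v (fa v)) (cwalks G v) k)
                     (fun w => conv (swalks H w (fa' w)) (cwalks H w) k).
  apply: dom_conv => a ak; split; [exact: desc_swalks|exact: desc_cwalks|exact: dom_swalks|].
  by have [] := IH a (leqW ak).
split.
  case=> [|i].
    case: rho_cases => r.
      by apply: dom_eq (domSC 0) => x lx; rewrite (cwalks_root1 rt, cwalks_root1 rt').
    have [_ /(_ r) le_r] := IH k (ltnSn k).
    by apply: dom_eq (dom_add (domSC 0) (dom_le le_r)) => x _; rewrite (cwalks_root2 rt, cwalks_root2 rt').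
  have domDC : dom i.+1 (fun v => conv (dwalks G v (fa v)) (cwalks G (fa v)) k)
                        (fun w => conv (dwalks H w (fa' w)) (cwalks H (fa' w)) k).
    apply: dom_conv => a ak; split; [exact: desc_dwalks| |exact: dom_dwalks|].
      move=> u v lu lv puv.
      have: pos (fa' u) <= pos (fa' v) by apply: (bp_fa bp puv); rewrite ?lu ?lv.
      rewrite leq_eqVlt => /orP[/eqP/pinj->//|].
      by apply: (desc_cwalks _ (i := i)); rewrite (rt_lev rt') ?lu ?lv.
    apply: (dom_father (f := fun v => cwalks G v a) (g := fun w => cwalks H w a)).
      exact: desc_cwalks.
    by have [] := IH a (leqW ak).
  by apply: dom_eq (dom_add (domSC i.+1) domDC) => x lx; rewrite (cwalks_nonroot rt, cwalks_nonroot rt') ?lx.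
move=> r2 v w lv lw.
have domSR : dom 0 (fun v => conv (swalks G v (fa v)) (rwalks G fa v) k)
                   (fun w => conv (swalks H w (fa' w)) (rwalks H fa' w) k).
  apply: dom_conv => a ak; split; [exact: desc_swalks| |exact: dom_swalks|].
    by move=> x y lx ly _; rewrite (rwalks_root rt' a lx ly).
  by apply: dom_le => x y; have [_] := IH a (leqW ak); apply.
have domC : dom 0 (fun v => cwalks G v k) (fun w => cwalks H w k) by have [] := IH k (ltnSn k).
have := dom_add domSR domC (subxx (L 0)).
rewrite same_levels (window_full bp) !big_split /=.
rewrite -(sum_roots_fa rt (cwalks G ^~ k) r2) -(sum_roots_fa rt' (cwalks H ^~ k) r2) -!big_split /=.
rewrite (eq_bigr (fun=> rwalks G fa v k.+1)) => [|x]; last first.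
  by rewrite inE => /eqP lx; rewrite -(rwalks_root rt _ lx lv) (rwalksS rt).
rewrite [leqRHS](eq_bigr (fun=> rwalks H fa' w k.+1)) => [|x]; last first.
  by rewrite inE => /eqP lx; rewrite -(rwalks_root rt' _ lx lw) (rwalksS rt').
have c2 (X : finType) (K : sgraph X) fx lx : rooting K rho fx lx -> #|level_set lx 0| = 2.
  by move=> h; rewrite -r2 -(rt_card h).
by rewrite !sum_nat_const (c2 _ _ _ _ rt) (c2 _ _ _ _ rt') leq_mul2l.
Qed.

Lemma dom_cwalks k i : dom i (fun v => cwalks G v k) (fun w => cwalks H w k).
Proof. by have [] := dom_cwalks_rwalks k. Qed.

(** Level by level, [U'] takes as many first vertices as [U] has vertices there. *)
Lemma dom_global f g : (forall i, dom i f g) -> forall U : {set V},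
  exists2 U' : {set W}, #|U'| = #|U| & \sum_(v in U) f v <= \sum_(w in U') g w.
Proof.
move=> d U; pose r i := #|U :&: L i|.
have rN i : r i <= #|L' i| by apply/card_sub_level/subsetIr.
pose U' := [set w | w \in win (lev' w) (r (lev' w))].
have [M [MV MW]] : exists M, (forall v, lev v < M) /\ forall w, lev' w < M.
  exists (maxn (\max_v lev v) (\max_w lev' w)).+1; split=> v; rewrite ltnS leq_max.
    by rewrite leq_bigmax.
  by rewrite orbC leq_bigmax.
have U'L i : U' :&: level_set lev' i = win i (r i).
  apply/setP => w; rewrite 2![in LHS]inE; apply/andP/idP => [[wU]|wi].
    by rewrite inE => /eqP <-.
  have := subsetP (window_level bp (rN i)) w wi; rewrite inE => lw.
  by rewrite (eqP lw); split=> //; rewrite inE lw.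
exists U'.
  rewrite -!sum1_card (sum_by_level _ _ MW) (sum_by_level _ _ MV).
  by apply: eq_bigr => i _; rewrite U'L !sum1_card (card_window bp).
rewrite (sum_by_level _ _ MV) [leqRHS](sum_by_level _ _ MW); apply: leq_sum => i _.
by rewrite U'L; apply: d; apply: subsetIr.
Qed.

(** By [dom_square_eq], a set [U] of largest branches of the level attains its bound. Sizes being
    one plus those of the child branches, the children of [U] attain the bound on the next level.
    Hence no gain is possible by exchanging an element of [U], or a child of one, against an
    outsider. *)
Lemma level_square_eq i :
  \sum_(w in L' i) #|side H w (fa' w)| ^ 2 <= \sum_(v in L i) #|side G v (fa v)| ^ 2 ->
  forall u w, lev u = i -> lev w = i -> u != w ->
  #|side G w (fa w)| <= #|side G u (fa u)| ->
  #|ch w| <= #|ch u| /\ forall a b, a \in ch u -> b \in ch w ->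
  #|side G b (fa b)| <= #|side G a (fa a)|.
Proof.
pose sz v := #|side G v (fa v)|; pose sz' w := #|side H w (fa' w)|.
move=> sq u w lu lw nuw szwu.
(* Leaving out [w] keeps this a set of largest branches, even if [u] and [w] tie, and separates [u]
   from [w]. *)
pose U := [set v in L i | (v != w) && (sz u <= sz v)].
have UL : U \subset L i by apply/subsetP => v; rewrite inE => /andP[].
have uU : u \in U by rewrite !inE lu eqxx nuw leqnn.
have wU : w \notin U by rewrite !inE eqxx andbF.
have wL : w \in L i by rewrite inE lw.
have := dom_square_eq (@desc_card_side i) (@dom_card_side i) sq UL.
move=> /(_ _)/wrap[x v|].
  rewrite 2!inE => /and3P[_ _ sx] vL; rewrite inE vL /= negb_and negbK -ltnNge.
  case/orP => [/eqP->|/ltnW sv]; [exact: leq_trans szwu sx|exact: leq_trans sv sx].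
rewrite (eq_bigr (fun v => 1 + \sum_(c in ch v) sz c)); last first.
  by move=> v _; rewrite (card_side_children rt).
rewrite [RHS](eq_bigr (fun v => 1 + \sum_(c in ch' v) sz' c)); last first.
  by move=> v _; rewrite (card_side_children rt').
rewrite !big_split /= !sum1_card (card_window bp) ?card_sub_level // => /addnI.
rewrite !sum_children_set (window_children rt' bp).
set e := \sum_(v in win i #|U|) #|ch' v|; set C := [set c | _].
have CL : C \subset L i.+1.
  apply/subsetP => c; rewrite !inE => /andP[lc /andP[/eqP <- _]].
  by rewrite (rt_lev rt) prednK.
have cC : #|C| = \sum_(v in U) #|ch v| by rewrite -card_children_sum.
have Ce : #|C| <= e by rewrite cC; apply: dom_card.
have ce : #|win i.+1 e| = e by rewrite -(window_children rt' bp) card_children_sum.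
have dC : \sum_(c in C) sz c <= \sum_(c in win i.+1 #|C|) sz' c by apply: dom_card_side.
move=> eqC.
(* If [C] were smaller, the window would contain a further branch of positive size, and the two sums
   could not agree. *)
have Ceq : #|C| = e.
  apply/eqP; rewrite eqn_leq Ce leqNgt; apply/negP => lt.
  have := dC; rewrite eqC leqNgt => /negP[].
  rewrite [ltnRHS](big_setID (win i.+1 #|C|)) /=.
  have /setIidPr -> := window_le lev' pos i.+1 Ce.
  rewrite -[ltnLHS]addn0 ltn_add2l.
  have: 0 < #|win i.+1 e :\: win i.+1 #|C| |.
    rewrite cardsD ce; have /setIidPr -> := window_le lev' pos i.+1 Ce.
    by rewrite (card_window bp) ?card_sub_level // subn_gt0.
  case/card_gt0P => x xD; rewrite (bigD1 x) //= /sz' (card_side_children rt').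
  by rewrite addSn.
split.
  have [cU] := exchange_set (fun v => #|ch v|) uU wU; apply.
  rewrite -cC Ceq /e -cU; apply: dom_card.
  by apply/subsetP => v; rewrite in_setU1 in_setD1 => /orP[/eqP->//|/andP[_ /(subsetP UL)]].
move=> a b au bw.
have aC : a \in C by move: au; rewrite inE => /andP[la /eqP fa_a]; rewrite inE la fa_a uU.
have bC : b \notin C by move: bw; rewrite inE => /andP[lb /eqP fa_b]; rewrite inE lb fa_b.
have [cC'] := exchange_set sz aC bC; apply.
rewrite eqC -Ceq -cC'; apply: dom_card_side.
apply/subsetP => v; rewrite in_setU1 in_setD1 => /orP[/eqP->|/andP[_ /(subsetP CL)//]].
move: bw; rewrite !inE => /andP[lb /eqP fa_b].
by have := rt_lev rt b; rewrite fa_b lw => ->; rewrite prednK.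
Qed.

End Compare.

(** * Rooting by distance to a vertex, and moving the root to an edge *)

Section Distance.
Variables (V : finType) (G : sgraph V).
Hypothesis treeG : is_tree G.
Implicit Types (u v r x y : V).

Let connG u v : connect (adj G) u v. Proof. by case: treeG. Qed.

Lemma dist_attained u v : exists p : seq V,
  [/\ path (adj G) u p, last u p = v & size p = dist G u v].
Proof.
pose a l := [exists p : l.-tuple V, path (adj G) u p && (last u p == v)].
have ha : has a (iota 0 #|V|).
  have /connectP[p pp E] := connG u v.
  case/shortenP: pp E => q pq uq _ E; apply/hasP; exists (size q).
    rewrite mem_iota /= add0n; have := max_card (mem (u :: q)).
    by rewrite (card_uniqP uq).
  by apply/existsP; exists (in_tuple q); rewrite /= pq E eqxx.
have := nth_find 0 ha; rewrite nth_iota ?add0n; last by rewrite -[ltnRHS](size_iota 0) -has_find.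
case/existsP => p /andP[pp /eqP lp]; exists p; split=> //; exact: size_tuple.
Qed.

Lemma dist_le u p : path (adj G) u p -> dist G u (last u p) <= size p.
Proof.
move=> pp; rewrite leqNgt; apply/negP => lt.
have ltn : size p < #|V|.
  by apply: leq_trans lt _; rewrite -[leqRHS](size_iota 0); apply: find_size.
have := before_find 0 lt; rewrite nth_iota // add0n => /negbT/existsPn/(_ (in_tuple p)).
by rewrite /= pp eqxx.
Qed.

Lemma level_root r : level G r r = 0.
Proof. by apply/eqP; rewrite -leqn0; apply: (@dist_le r [::]). Qed.

Lemma level_eq0 r v : level G r v = 0 -> v = r.
Proof.
move=> l0; have [[|x p] [_ lp sp]] := dist_attained r v; first by rewrite -lp.
by rewrite -/(level G r v) l0 in sp.
Qed.

Lemma level_adj r u v : adj G u v -> level G r v <= (level G r u).+1.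
Proof.
move=> uv; have [p [pp lp sp]] := dist_attained r u.
have := @dist_le r (rcons p v); rewrite rcons_path last_rcons size_rcons pp lp sp; exact.
Qed.

Lemma father_adj r v : v != r -> adj G v (father G r v) /\ level G r v = (level G r (father G r v)).+1.
Proof.
move=> nvr; rewrite /father; case: pickP => [u /andP[vu /eqP lv]|none] /=; first by [].
have [p [pp lp sp]] := dist_attained r v.
case/lastP: p => [|p u] in pp lp sp *; first by rewrite -lp eqxx in nvr.
move: pp lp sp; rewrite rcons_path last_rcons size_rcons => /andP[pp pu] uv sp.
rewrite {u}uv in pu.
have := none (last r p); rewrite adj_sym pu /= => /negbT/negP[].
rewrite eqn_leq level_adj //= /level -sp ltnS; exact: dist_le.
Qed.

Lemma father_root r : father G r r = r.
Proof. by rewrite /father; case: pickP => [u /andP[_]|//]; rewrite level_root. Qed.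

Lemma rooting_level r : rooting G 1 (father G r) (level G r).
Proof.
have lev_eq0 v : (level G r v == 0) = (v == r).
  by apply/eqP/eqP => [/level_eq0//|->]; rewrite level_root.
split=> //.
- move=> u v; apply/idP/andP => [uv|[nuv]].
    split; first exact: adj_neq uv.
    rewrite -[_ || _]negbK negb_or; apply/negP => /andP[fu fv].
    (* If neither end were the father of the other, the steps to fathers would avoid the edge [uv]
       and connect its ends through the root. *)
    have toroot x : connect (cut G u v) x r.
      move: {2}(level G r x) (leqnn (level G r x)) => n.
      elim: n x => [|n IH] x; first by rewrite leqn0 lev_eq0 => /eqP->.
      case: (eqVneq x r) => [->//|nxr] lx.
      have [xf lf] := father_adj nxr.
      apply: connect_trans (connect1 _) (IH (father G r x) _); last by rewrite -ltnS -lf.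
      rewrite /cut /= xf negb_or /=; apply/andP; split.
        by apply: contra fu => /andP[/eqP<-].
      by apply: contra fv => /andP[/eqP<-].
    have /negP[] := side_notin treeG uv; rewrite inE.
    apply: connect_trans (toroot u) _.
    by rewrite (sym_connect_sym (cut_sym G u v)).
  case/orP => /eqP E.
    have [|uf _] := @father_adj r u; last by rewrite -E.
    by apply: contra nuv => /eqP ur; rewrite -E ur father_root.
  have [|vf _] := @father_adj r v; last by rewrite adj_sym -E.
  by apply: contra nuv => /eqP vr; rewrite -E vr father_root.
- move=> v; case: (eqVneq v r) => [->|nvr]; first by rewrite father_root level_root.
  by have [_ ->] := father_adj nvr.
- by move=> u v nuv /level_eq0 ur /level_eq0 vr; rewrite ur vr eqxx in nuv.
- rewrite (_ : finset _ = [set r]) ?cards1 //.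
  by apply/setP => v; rewrite !inE lev_eq0.
Qed.

End Distance.

Section EdgeRoot.
Variables (V : finType) (G : sgraph V) (fa : V -> V) (lev : V -> nat).
Hypothesis rt : rooting G 1 fa lev.
Variables x z : V.
Hypotheses (lx : lev x = 0) (xz : adj G x z).

Let treeG := rooting_tree rt.

Lemma root_unique u v : lev u = 0 -> lev v = 0 -> u = v.
Proof.
move=> lu lv; apply/eqP/negPn/negP => nuv; case/eqP: (nuv).
by rewrite -(fa_root1 rt _ lu) //; apply: (rt_root rt).
Qed.

(** The root [x] receives [z] as father, and the whole branch of [z] moves up one level, so that [z]
    becomes the second root. *)
Definition edge_fa v := if v == x then z else fa v.
Definition edge_lev v := lev v - (v \in side G z x).

Lemma rooting_edge : rooting G 2 edge_fa edge_lev.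
Proof.
have fx : fa x = x by apply: (fa_root1 rt).
have nxz := adj_neq xz; have zx : adj G z x by rewrite adj_sym.
have fz : fa z = x.
  by move: xz; rewrite (rt_adj rt) fx (negbTE nxz) /= => /eqP.
have xS : x \notin side G z x by apply: side_notin.
have zS : z \in side G z x by apply: side_refl.
have lz : lev z = 1.
  have := rt_lev rt z; rewrite fz lx; case E: (lev z) => [|[]] //= _.
  by rewrite (root_unique E lx) eqxx in nxz.
have pos v : v != x -> 0 < lev v.
  by move=> nvx; rewrite lt0n; apply: contra nvx => /eqP l0; rewrite (root_unique l0 lx).
have l2 v : (edge_lev v == 0) = (v == x) || (v == z).
  rewrite /edge_lev; case: (eqVneq v x) => [->|nvx]; first by rewrite lx.
  case: (eqVneq v z) => [->|nvz]; first by rewrite lz zS.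
  have lv := pos _ nvx; case: (boolP (v \in _)) => vS; last by rewrite subn0 eqn0Ngt lv.
  rewrite subn_eq0 leqNgt ltn_neqAle lv andbT negbK; apply/eqP => l1; have fv : fa v = x by apply: root_unique => //; rewrite (rt_lev rt) -l1.
  have vx : adj G v x by rewrite -fv; apply: (adj_fa rt).
  by have [/eqP] := side_exit treeG zx vS xS vx; rewrite (negbTE nvz).
split=> //.
- move=> u v; rewrite (rt_adj rt) /edge_fa; case: (eqVneq u v) => //= nuv.
  case: (eqVneq u x) => [ux|nux]; case: (eqVneq v x) => [vx|nvx] //.
  + by rewrite ux vx eqxx in nuv.
  + rewrite ux fx eq_sym (negbTE nvx) /=.
    by case: (eqVneq z v) => // <-; rewrite fz eqxx.
  + rewrite vx fx [x == u]eq_sym (negbTE nux) orbF.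
    by case: (eqVneq z u) => [<-|]; rewrite ?orbF // fz eqxx.
- move=> v; case: (eqVneq v x) => [->|nvx].
    rewrite /edge_fa eqxx; have := l2 z; rewrite eqxx orbT => /eqP->.
    by have := l2 x; rewrite eqxx => /eqP->.
  rewrite /edge_fa (negbTE nvx) /edge_lev (rt_lev rt).
  have vf := adj_fa rt (pos _ nvx).
  case: (boolP (v \in side G z x)) => vS; case: (boolP (fa v \in side G z x)) => fS //=.
  + by rewrite !subn1.
  + by have [-> _] := side_exit treeG zx vS fS vf; rewrite lz.
  + have fv : adj G (fa v) v by rewrite adj_sym.
    by have [_ /eqP] := side_exit treeG zx fS vS fv; rewrite (negbTE nvx).
  + by rewrite !subn0.
- move=> u v nuv /eqP; rewrite l2 => lu /eqP; rewrite l2 => lv; rewrite /edge_fa.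
  case/orP: lu => /eqP ux; case/orP: lv => /eqP vx; rewrite ux vx ?eqxx // in nuv *.
  by rewrite eq_sym (negbTE nxz).
- rewrite (_ : finset _ = [set x; z]) ?cards2 ?nxz //.
  by apply/setP => v; rewrite !inE l2.
Qed.

End EdgeRoot.

(** * Rearranging a rooted tree with its levels and degrees kept *)

Lemma exists_level_pos (V : finType) (lev h : V -> nat) : exists2 pos : V -> nat,
  level_pos lev pos & forall u v, lev u = lev v -> pos u < pos v -> h v <= h u.
Proof.
pose le u v := (lev u < lev v) || (lev u == lev v) && (h v <= h u).
have tot : total le by move=> u v; rewrite /le; lia.
have tr : transitive le by move=> u v w; rewrite /le; lia.
pose l := sort le (enum V); have ml v : v \in l by rewrite mem_sort mem_enum.
have ul : uniq l by rewrite sort_uniq enum_uniq.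
have le_pos u v : index u l < index v l -> le u v.
  move=> uv; have sl : sorted le l by apply: sort_sorted.
  by have := sorted_ltn_nth tr u sl; move/(_ _ _ _ _ uv); rewrite !inE !index_mem !nth_index //; apply.
exists (fun v => index v l); first split.
- by move=> u v; apply: (index_inj u (ml u) (ml v)).
- by move=> v; rewrite cardT -(size_sort le) index_mem.
- move=> u v; rewrite leq_eqVlt => /orP[/eqP/(index_inj u (ml u) (ml v))->//|/le_pos].
  by rewrite /le; lia.
- by move=> u v luv /le_pos; rewrite /le luv ltnn eqxx.
Qed.

Lemma leq_sum_window_top (V : finType) (lev pos h : V -> nat) i (s : {set V}) :
  level_pos lev pos ->
  (forall u v, lev u = lev v -> pos u < pos v -> h v <= h u) ->
  s \subset level_set lev i ->
  \sum_(v in s) h v <= \sum_(v in window lev pos i #|s|) h v.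
Proof.
move=> lp dh sL; have sN : #|s| <= #|level_set lev i| by apply: subset_leq_card.
apply: leq_sum_top; first by rewrite (card_window lp).
move=> a b aw bs bw; have := subsetP (window_level lp sN) a aw; rewrite inE => /eqP la.
have := subsetP sL b bs; rewrite inE => /eqP lb.
apply: dh; first by rewrite la.
have := lev_eq_pos lp i b; rewrite lb eqxx => /esym.
by move: aw bw; rewrite !inE; lia.
Qed.

Section Resort.
Variables (V : finType) (G : sgraph V) (rho : nat) (fa : V -> V) (lev pos : V -> nat).
Hypotheses (rt : rooting G rho fa lev) (lp : level_pos lev pos).

Local Notation ch := (children fa lev).
Local Notation B := (below lev).
Local Notation E q := (\sum_(v | pos v < q) #|ch v|).

(** The first position for the children of [f] when, after the [rho] roots, children are handed out
    to the vertices in order of position. *)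
Let start f := rho + E (pos f).

Let ES f : E (pos f).+1 = E (pos f) + #|ch f|.
Proof.
rewrite (bigD1 f) //= addnC; congr (_ + _); apply: eq_bigl => v.
by rewrite -(inj_eq (lp_inj lp)); lia.
Qed.

Let E_le a b : a <= b -> E a <= E b.
Proof.
move=> ab; rewrite [leqRHS](bigID (fun v => pos v < a)) /=.
apply: leq_trans (leq_addr _ _); rewrite leq_eqVlt; apply/orP; left; apply/eqP.
by apply: eq_bigl => v; lia.
Qed.

Definition new_father w f := start f <= pos w < start f + #|ch f|.

(** The roots keep their fathers; for other vertices the default value is never reached, by
    [resort_faP]. *)
Definition resort_fa w := if lev w == 0 then fa w else odflt (fa w) [pick f | new_father w f].

Lemma new_father_uniq w f f' : new_father w f -> new_father w f' -> f = f'.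
Proof.
rewrite /new_father /start => h h'; apply: (lp_inj lp).
case: (ltngtP (pos f) (pos f')) => // /E_le; rewrite ES; lia.
Qed.

Lemma resort_faP w : 0 < lev w -> new_father w (resort_fa w).
Proof.
move=> lw; rewrite /resort_fa -[lev w == 0]negbK -lt0n lw /=; case: pickP => //= none.
(* The intervals of new children tile the positions from [rho] to the end, so a non-root outside all
   of them would lie past the last position. *)
have Etot : rho + E #|V| = #|V|.
  rewrite -(rt_card rt) -[RHS](cardC [in [set v | lev v == 0]]); congr (_ + _).
  rewrite (eq_bigl [in setT]) => [|v]; last by rewrite inE (lp_lt lp).
  rewrite -card_children_sum; apply: eq_card => v; rewrite !inE andbT; exact: lt0n.
have small q : q <= #|V| -> rho + E q <= pos w.
  elim: q => [|q IH] qn.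
    rewrite big_pred0 // addn0 -(below1 rt) leqNgt -(lev_lt_pos lp); lia.
  have [f pf] := pos_onto (lp_inj lp) (lp_lt lp) qn.
  have := IH (ltnW qn); rewrite -pf ES => le; have := none f.
  rewrite /new_father /start le /= addnA; lia.
by have := small _ (leqnn _); rewrite Etot leqNgt (lp_lt lp).
Qed.

Lemma resort_fa_root w : lev w = 0 -> resort_fa w = fa w.
Proof. by rewrite /resort_fa => ->. Qed.

Lemma lev_resort_fa w : lev (resort_fa w) = (lev w).-1.
Proof.
case: (posnP (lev w)) => [lw|lw]; first by rewrite resort_fa_root // (rt_lev rt) lw.
have := resort_faP lw; move: (resort_fa w) => f; rewrite /new_father /start -addnA -ES.
case/andP=> le_w w_lt; case lwE: (lev w) lw => [//|i] _ /=.
(* The ends of the levels and the intervals of new children are computed from the same partial sums.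
   A new father before or after level [i] would thus put [w] before or after level [i.+1]. *)
have Bw j : (lev w < j.+1) = (pos w < rho + E (B j)).
  by rewrite (lev_lt_pos lp) (belowS_children rt lp).
apply/eqP; rewrite (lev_eq_pos lp); apply/andP; split; rewrite leqNgt; apply/negP => f_lt.
  have wi : pos w < rho + E (B i) by apply: leq_trans w_lt _; rewrite leq_add2l E_le.
  by rewrite -Bw lwE ltnn in wi.
have wi : rho + E (B i.+1) <= pos w by apply: leq_trans le_w; rewrite leq_add2l E_le.
by rewrite leqNgt -Bw lwE ltnSn in wi.
Qed.

Definition resort_rel : rel V :=
  [rel u v | (u != v) && ((resort_fa u == v) || (resort_fa v == u))].

Lemma resort_sym : symmetric resort_rel.
Proof. by move=> u v; rewrite /resort_rel /= eq_sym orbC. Qed.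

Lemma resort_irr : irreflexive resort_rel.
Proof. by move=> u; rewrite /resort_rel /= eqxx. Qed.

Definition resort := SGraph resort_sym resort_irr.

Lemma rooting_resort : rooting resort rho resort_fa lev.
Proof.
split=> //; [exact: lev_resort_fa| |exact: rt_card rt|exact: rt_gt0 rt].
by move=> u v nuv lu lv; rewrite resort_fa_root ?(rt_root rt nuv).
Qed.

Lemma bfs_pos_resort : bfs_pos resort_fa lev pos.
Proof.
split=> // u v uv /resort_faP/andP[hu _] /resort_faP/andP[_ hv].
rewrite leqNgt; apply/negP => /E_le; rewrite ES; move: hu hv; rewrite /start; lia.
Qed.

Lemma card_children_resort f : #|children resort_fa lev f| = #|ch f|.
Proof.
have fE : start f + #|ch f| <= #|V|.
  rewrite /start -addnA -ES -[leqRHS](cardC [in [set v | lev v == 0]]) (rt_card rt) leq_add2l.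
  have := card_children_sum fa lev [set v | pos v < (pos f).+1].
  under eq_bigl do rewrite inE; move=> <-; apply: subset_leq_card.
  by apply/subsetP => v; rewrite !inE -lt0n => /andP[].
rewrite -[RHS](card_pos_interval (lp_inj lp) (lp_lt lp) fE).
apply: eq_card => w; rewrite !inE; apply/andP/idP => [[lw /eqP<-]|h]; first exact: resort_faP.
have lw : 0 < lev w.
  rewrite lt0n; apply/negP => /eqP lw.
  have : pos w < B 1 by rewrite -(lev_lt_pos lp) lw.
  by rewrite (below1 rt); move: h; rewrite /start; lia.
by split=> //; apply/eqP; apply: new_father_uniq (resort_faP lw) h.
Qed.

Lemma deg_resort v : deg resort v = deg G v.
Proof.
rewrite (deg_children rooting_resort) (deg_children rt) card_children_resort; congr (_ + _).
case: (posnP (lev v)) => [lv|lv]; first by rewrite resort_fa_root.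
by rewrite (adj_neq (adj_fa rt lv)) (adj_neq (adj_fa rooting_resort lv)).
Qed.

Lemma degree_sequence_resort : degree_sequence resort = degree_sequence G.
Proof. by congr sort; apply: eq_map => v; apply: deg_resort. Qed.

End Resort.

(** * The edge energy under rearrangement *)

Section Energy.
Variables (V : finType) (G : sgraph V) (rho : nat) (fa : V -> V) (lev : V -> nat).
Hypothesis rt : rooting G rho fa lev.

Local Notation ch := (children fa lev).
Local Notation L := (level_set lev).
Local Notation sz v := #|side G v (fa v)|.

Let treeG := rooting_tree rt.

Lemma children_level i : [set c | (0 < lev c) && (fa c \in L i)] = L i.+1.
Proof. by apply/setP => c; rewrite !inE (rt_lev rt); lia. Qed.

(** The branches at level [i] partition the vertices of level at least [i]. The sum depends on the
    levels only, so a rearrangement does not change it. *)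
Lemma sum_level_side i : \sum_(v in L i) sz v = #|[set v | i <= lev v]|.
Proof.
have [M MP] : exists M, forall v, lev v < M.
  by exists (\max_v lev v).+1 => v; rewrite ltnS; apply: leq_bigmax.
move: {2}(M - i) (leqnn (M - i)) => n; elim: n i => [|n IH] i Mi.
  rewrite big1 => [|v]; last by rewrite inE; have := MP v; lia.
  by apply/esym/eqP; rewrite cards_eq0; apply/eqP/setP => v; rewrite !inE; have := MP v; lia.
rewrite (eq_bigr (fun v => 1 + \sum_(c in ch v) sz c)) => [|v _]; last first.
  exact: (card_side_children rt).
rewrite big_split /= sum1_card sum_children_set children_level IH; last by lia.
rewrite -(cardsID (L i) [set v | i <= lev v]); congr (_ + _); apply: eq_card => v.
  by rewrite !inE; lia.
by rewrite !inE; lia.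
Qed.

(** The oriented edges are the pairs [(v, fa v)] for all [v], which count the root edge in both
    directions, and the pairs [(fa v, v)] for non-roots [v], whose near side has [#|V| - sz v]
    vertices. The square of this difference is expanded with its cross term on the left, to avoid
    subtraction. *)
Lemma edge_energy2 : rho = 2 ->
  edge_energy G + 2 * #|V| * \sum_(v | 0 < lev v) sz v
  = \sum_v sz v ^ 2 + \sum_(v | 0 < lev v) (#|V| ^ 2 + sz v ^ 2).
Proof.
move=> r2.
have -> : edge_energy G = \sum_v sz v ^ 2 + \sum_(v | 0 < lev v) #|side G (fa v) v| ^ 2.
  rewrite /edge_energy.
  have -> : \sum_(v | 0 < lev v) #|side G (fa v) v| ^ 2
      = \sum_(v in setT) \sum_(c in ch v) #|side G (fa c) c| ^ 2.
    by rewrite sum_children_set; apply: eq_bigl => v; rewrite !inE andbT.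
  rewrite (eq_bigl xpredT _ (fun v => in_setT v)) -big_split /=; apply: eq_bigr => v _.
  rewrite (bigD1 (fa v)) ?(adj_fa2 rt) //=; congr (_ + _).
  apply: eq_big => c; rewrite -?(childrenE rt) //.
  by rewrite inE => /andP[_ /eqP->].
rewrite -addnA; congr (_ + _); rewrite big_distrr -big_split /=; apply: eq_bigr => v lv.
by rewrite -(card_sideC treeG (adj_fa rt lv)) !expnS !expn0 !muln1; nia.
Qed.

End Energy.

(** The cross terms of [edge_energy2] are linear in the branch sizes, hence equal for both trees.
    Only sums of squares are left, and these can agree in total only if they agree on every
    level. *)
Lemma edge_energy_mono (V : finType) (lev : V -> nat) (G G' : sgraph V) fa fa' :
  rooting G 2 fa lev -> rooting G' 2 fa' lev ->
  (forall i, \sum_(v in level_set lev i) #|side G v (fa v)| ^ 2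
     <= \sum_(v in level_set lev i) #|side G' v (fa' v)| ^ 2) ->
  edge_energy G <= edge_energy G' /\ (edge_energy G' <= edge_energy G -> forall i,
     \sum_(v in level_set lev i) #|side G' v (fa' v)| ^ 2
     <= \sum_(v in level_set lev i) #|side G v (fa v)| ^ 2).
Proof.
move=> rt rt' le.
have [M MP] : exists M, forall v, lev v < M.
  by exists (\max_v lev v).+1 => v; rewrite ltnS; apply: leq_bigmax.
have posE h : \sum_(v | 0 < lev v) h v
    = \sum_(i < M) (if i == 0 :> nat then 0 else \sum_(v in level_set lev i) h v).
  rewrite -(eq_bigl _ _ (fun v => in_set (fun v => 0 < lev v) v)) (sum_by_level _ _ MP).
  apply: eq_bigr => -[[|i] /= _] _.
    by rewrite big_pred0 // => v; rewrite !inE; case: (lev v).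
  by apply: eq_bigl => v; rewrite !inE; case: (lev v).
have eq1 : \sum_(v | 0 < lev v) #|side G v (fa v)| = \sum_(v | 0 < lev v) #|side G' v (fa' v)|.
  by rewrite !posE; apply: eq_bigr => i _; rewrite (sum_level_side rt) (sum_level_side rt').
have le1 : \sum_(v | 0 < lev v) #|side G v (fa v)| ^ 2 <= \sum_(v | 0 < lev v) #|side G' v (fa' v)| ^ 2.
  by rewrite !posE; apply: leq_sum => i _; case: ifP.
have allE h : \sum_v h v = \sum_(i < M) \sum_(v in level_set lev i) h v.
  rewrite (eq_bigl _ _ (fun v => esym (in_setT v))) (sum_by_level _ _ MP).
  by apply: eq_bigr => i _; rewrite setTI.
have le2 : \sum_v #|side G v (fa v)| ^ 2 <= \sum_v #|side G' v (fa' v)| ^ 2.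
  by rewrite !allE; apply: leq_sum => i _; apply: le.
have := edge_energy2 rt erefl; have := edge_energy2 rt' erefl; rewrite !big_split /= eq1.
move: (2 * _ * _) => Y e' e; split; first by move: e e' le1 le2; lia.
move=> ee.
have le3 : \sum_v #|side G' v (fa' v)| ^ 2 <= \sum_v #|side G v (fa v)| ^ 2.
  by move: e e' le1 le2 ee; lia.
move: le3; rewrite !allE => le3 i; case: (ltnP i M) => iM; last first.
  rewrite big_pred0 // => v; rewrite inE; apply/negbTE; move: (MP v); lia.
rewrite leqNgt; apply/negP => lt; move: le3; rewrite leqNgt => /negP[].
rewrite [ltnLHS](bigD1 (Ordinal iM)) //= [ltnRHS](bigD1 (Ordinal iM)) //= -addSn.
by apply: leq_add => //; apply: leq_sum.
Qed.

(** This form of majorization refers to no sorting and to no rooting, so rearrangements made at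
    different roots compose. *)
Definition walks_le (V W : finType) (G : sgraph V) (H : sgraph W) : Prop :=
  forall k (U : {set V}), exists2 U' : {set W}, #|U'| = #|U| &
    \sum_(v in U) cwalks G v k <= \sum_(w in U') cwalks H w k.

Lemma walks_le_trans (V W X : finType) (G : sgraph V) (H : sgraph W) (K : sgraph X) :
  walks_le G H -> walks_le H K -> walks_le G K.
Proof.
move=> GH HK k U; have [U' c' le'] := GH k U; have [U'' c'' le''] := HK k U'.
by exists U''; [rewrite c''|apply: leq_trans le' le''].
Qed.

(** The last clause is about [G] itself: if the energy does not rise, then [G] was already arranged
    by branch sizes with respect to this root edge. *)
Lemma resort_improves (V : finType) (G : sgraph V) fa lev : rooting G 2 fa lev ->
  exists G' : sgraph V, [/\ is_tree G', degree_sequence G' = degree_sequence G,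
    walks_le G G', edge_energy G <= edge_energy G' &
    edge_energy G' <= edge_energy G ->
    forall u w, lev u = lev w -> u != w -> #|side G w (fa w)| <= #|side G u (fa u)| ->
    #|children fa lev w| <= #|children fa lev u| /\
    forall a b, a \in children fa lev u -> b \in children fa lev w ->
      #|side G b (fa b)| <= #|side G a (fa a)|].
Proof.
move=> rt; have [pos lp dc] := exists_level_pos lev (fun v => #|children fa lev v|).
set fa' := resort_fa 2 fa lev pos; pose G' := resort 2 fa lev pos.
have rt' : rooting G' 2 fa' lev := rooting_resort rt lp.
have bp : bfs_pos fa' lev pos := bfs_pos_resort rt lp.
have cc v : #|children fa' lev v| = #|children fa lev v| := card_children_resort rt lp v.
have same i : #|level_set lev i| = #|level_set lev i| by [].
have dom_c i : dom lev lev pos i (fun v => #|children fa lev v|) (fun w => #|children fa' lev w|).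
  by move=> s sL; under [leqRHS]eq_bigr do rewrite cc; apply: leq_sum_window_top.
have desc_c i : desc lev pos i (fun w => #|children fa' lev w|).
  by move=> u v lu lv; rewrite !cc; apply: dc; rewrite lu.
have squares i : \sum_(v in level_set lev i) #|side G v (fa v)| ^ 2
    <= \sum_(v in level_set lev i) #|side G' v (fa' v)| ^ 2.
  have dsz := dom_card_side rt rt' bp same dom_c (i := i).
  have desc_sz := desc_card_side rt' bp desc_c (i := i).
  by have := dom_mul bp same desc_sz desc_sz dsz dsz (subxx _); rewrite (window_full bp).
have [en en_eq] := edge_energy_mono rt rt' squares.
exists G'; split=> //.
- exact: rooting_tree rt'.
- exact: degree_sequence_resort rt lp.
- move=> k U; apply: (dom_global bp same) => i; exact: (dom_cwalks rt rt' bp same dom_c desc_c (leqnn 2)).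
- move=> le u w luw nuw szwu.
  exact: (level_square_eq rt rt' bp same dom_c desc_c (en_eq le (lev u)) erefl (esym luw) nuw szwu).
Qed.

Lemma exists_edge_rooting (V : finType) (G : sgraph V) x z : is_tree G -> adj G x z ->
  exists fa lev, [/\ rooting G 2 fa lev, lev x = 0, lev z = 0, fa x = z & fa z = x].
Proof.
move=> treeG xz; have rt := rooting_level treeG x.
have rt2 := rooting_edge rt (level_root G x) xz.
have: edge_lev G (level G x) x z x = 0 by rewrite /edge_lev level_root.
have: edge_fa (father G x) x z x = z by rewrite /edge_fa eqxx.
move: (edge_fa _ _ _) (edge_lev _ _ _ _) rt2 => fa lev rt2 fx lx; exists fa, lev.
have lz : lev z = 0 by rewrite -fx (rt_lev rt2) lx.
by split=> //; apply: (rt_root rt2) => //; rewrite eq_sym (adj_neq xz).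
Qed.

(** * Ascent to a tree whose degrees decrease along the levels from a centroid *)

(** Branches are nested, so the bound at the children of the centroid passes down. *)
Lemma centroid_side (V : finType) (G : sgraph V) fa lev r : rooting G 1 fa lev ->
  lev r = 0 -> (forall c, adj G c r -> #|side G c r|.*2 <= #|V|) ->
  forall z, 0 < lev z -> #|side G z (fa z)|.*2 <= #|V|.
Proof.
move=> rt lr cr z; move: {2}(lev z) (leqnn (lev z)) => n; elim: n z => [|n IH] z ln lz; first by lia.
have zf := adj_fa rt lz; have lf := rt_lev rt z.
case: (posnP (lev (fa z))) => lfz.
  by rewrite (root_unique rt lfz lr) in zf *; apply: cr.
apply: leq_trans (IH (fa z) _ lfz); last by lia.
rewrite leq_double; apply/subset_leq_card/(side_sub (rooting_tree rt) zf).
by apply/eqP => E; have := rt_lev rt (fa z); rewrite -E; lia.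
Qed.

Lemma lev_iter (V : finType) (G : sgraph V) rho fa lev (rt : rooting G rho fa lev) v j :
  lev (iter j fa v) = lev v - j.
Proof. by elim: j => [|j IH]; rewrite ?subn0 //= (rt_lev rt) IH subnS. Qed.

(* Re-rooting only reverses the edges on the way to the new root. *)
Lemma chain_rooting (V : finType) (G : sgraph V) fa lev fa2 lev2 v i :
  rooting G 1 fa lev -> rooting G 2 fa2 lev2 -> i <= lev v ->
  lev2 (iter i fa v) = 0 -> (0 < i -> fa2 (iter i fa v) <> iter i.-1 fa v) ->
  forall t, t <= i -> lev2 (iter (i - t) fa v) = t /\
    (0 < t -> fa2 (iter (i - t) fa v) = iter (i - t).+1 fa v).
Proof.
move=> rt rt2 iv l0 nf; elim=> [|t IH] ti; first by rewrite subn0.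
have [lb fb] := IH (ltnW ti).
have Eb : i - t = (i - t.+1).+1 by lia.
move: lb fb; rewrite Eb /=; set a := iter (i - t.+1) fa v => lb fb.
have la : lev a = lev v - (i - t.+1) := lev_iter rt _ _.
have ab : adj G a (fa a) by apply: (adj_fa rt); rewrite la; lia.
have nba : fa2 (fa a) <> a.
  case: (posnP t) => [t0|t_gt0 E].
    have := nf (leq_trans (ltn0Sn t) ti); have -> : i.-1 = i - t.+1 by lia.
    by have -> : iter i fa v = fa a by rewrite /a -iterS; congr iter; lia.
  have := rt_lev rt (fa a); have := rt_lev rt a.
  by rewrite -(fb t_gt0) E la; lia.
have fa2a : fa2 a = fa a.
  by move: ab; rewrite (rt_adj rt2) => /andP[_ /orP[/eqP//|/eqP]].
split=> //; have := rt_lev rt2 a; rewrite fa2a lb.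
case: (posnP (lev2 a)) => [l2a t0|]; last by lia.
by case: nba; apply: (rt_root rt2); [rewrite eq_sym; exact: adj_neq ab|rewrite lb t0 l2a|].
Qed.

Lemma level_monotone (V : finType) (G : sgraph V) rho fa lev (h : V -> nat) :
  rooting G rho fa lev -> (forall u w, lev w = (lev u).+1 -> h w <= h u) ->
  forall u w, lev u < lev w -> h w <= h u.
Proof.
move=> rt mono u w; move: {2}(lev w) (leqnn (lev w)) => n.
elim: n w => [|n IH] w ln luw; first by lia.
have lf := rt_lev rt w; have : h w <= h (fa w) by apply: mono; lia.
case: (ltngtP (lev u) (lev (fa w))) => [lt le|gt|eq le]; last by apply: mono; lia.
  by apply: leq_trans le (IH _ _ lt); lia.
by lia.
Qed.

(* If u and w on consecutive levels have the wrong degrees, then seen from the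
   edge xz in the middle of the path between them they are at the same level,
   and in a tree of maximal energy the side of z would be larger than that of x,
   against the choice of the centroid. *)
Lemma improve (V : finType) (G : sgraph V) fa lev r u w : rooting G 1 fa lev ->
  lev r = 0 -> (forall c, adj G c r -> #|side G c r|.*2 <= #|V|) ->
  lev w = (lev u).+1 -> deg G u < deg G w ->
  exists G' : sgraph V, [/\ is_tree G', degree_sequence G' = degree_sequence G,
    walks_le G G' & edge_energy G < edge_energy G'].
Proof.
move=> rt lr cr luw duw; have treeG := rooting_tree rt.
pose y j := iter j fa u; pose v j := iter j fa w.
have ly j : lev (y j) = lev u - j := lev_iter rt u j.
have lv j : lev (v j) = lev w - j := lev_iter rt w j.
have ex : exists j, fa (v j) == y j.
  exists (lev u); apply/eqP; apply: (root_unique rt); last by rewrite ly subnn.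
  by rewrite (rt_lev rt) lv; lia.
(* By minimality [y i] is the lowest common ancestor. It is [i] steps above [u], and [v i] is [i]
   steps above [w], so the edge between them is the middle of the path. *)
case: (ex_minnP ex) => i /eqP vi mini.
have iu : i <= lev u.
  apply: mini; apply/eqP; apply: (root_unique rt); last by rewrite ly subnn.
  by rewrite (rt_lev rt) lv; lia.
have zx : adj G (v i) (y i) by rewrite -vi; apply: (adj_fa rt); rewrite lv; lia.
have xz : adj G (y i) (v i) by rewrite adj_sym.
have [fa2 [lev2 [rt2 lx lz fx fz]]] := exists_edge_rooting treeG xz.
have chain_y := chain_rooting (v := u) rt rt2 iu lx.
have iw : i <= lev w by lia.
have chain_v := chain_rooting (v := w) rt rt2 iw lz.
have {chain_y} cy t : t <= i -> lev2 (y (i - t)) = t /\ (0 < t -> fa2 (y (i - t)) = y (i - t).+1).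
  apply: chain_y => i0; rewrite -/(y _) fx => E.
  have: fa (v i.-1) == y i.-1 by rewrite /v -iterS prednK //; apply/eqP.
  by move/mini; lia.
have {chain_v} cv t : t <= i -> lev2 (v (i - t)) = t /\ (0 < t -> fa2 (v (i - t)) = v (i - t).+1).
  apply: chain_v => i0; rewrite -/(v _) fz => E.
  by have := ly i; rewrite E (lev_iter rt); lia.
have [G' [treeG' deg' le' en star]] := resort_improves rt2.
exists G'; split=> //; rewrite ltnNge; apply/negP => {}/star star.
have lyv j : j <= i -> lev2 (y j) = lev2 (v j).
  move=> ji; have [+ _] := cy (i - j) (leq_subr _ _); have [+ _] := cv (i - j) (leq_subr _ _).
  by rewrite subKn // => -> ->.
have nyv j : j <= i -> y j != v j.
  by move=> ji; apply/eqP => E; have := ly j; rewrite E lv; lia.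
have step j : j < i -> y j \in children fa2 lev2 (y j.+1) /\ v j \in children fa2 lev2 (v j.+1).
  move=> ji; have pj : 0 < i - j by rewrite subn_gt0.
  have [ly2 fy2] := cy _ (leq_subr j i); have [lv2 fv2] := cv _ (leq_subr j i).
  move: ly2 fy2 lv2 fv2; rewrite subKn ?(ltnW ji) // => ly2 fy2 lv2 fv2.
  by rewrite !inE ly2 lv2 fy2 // fv2 // !eqxx andbT.
(* The contrapositive of [star], climbing both halves of the path: fewer children make the branch of
   [u] the smaller one, and a smaller child branch forces a smaller branch at its father. *)
have lt j : j <= i -> #|side G (y j) (fa2 (y j))| < #|side G (v j) (fa2 (v j))|.
  elim: j => [|j IH] ji; rewrite ltnNge; apply/negP => le.
    have [ch _] := star _ _ (lyv 0 ji) (nyv 0 ji) le.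
    move: duw; rewrite !(deg_children rt2) !(adj_neq (adj_fa2 rt2 _ erefl)).
    by rewrite ltn_add2r ltnNge ch.
  have [_ ch] := star _ _ (lyv _ ji) (nyv _ ji) le.
  have [yc vc] := step j ji.
  by have := IH (ltnW ji); rewrite ltnNge (ch _ _ yc vc).
have := lt i (leqnn i); rewrite fx fz => lt_side.
have: #|side G (v i) (y i)|.*2 <= #|V|.
  by rewrite -vi; apply: (centroid_side rt lr cr); rewrite lv; lia.
by rewrite -(card_sideC treeG xz) -addnn leq_add2r leqNgt lt_side.
Qed.

(** Each use of [improve] raises the energy, which is bounded. The centroid is chosen anew in every
    round, as the previous one need not be a centroid of the new tree. *)
Lemma exists_level_monotone (V : finType) (G : sgraph V) : is_tree G ->
  exists G' : sgraph V, [/\ is_tree G', degree_sequence G' = degree_sequence G,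
    walks_le G G' & exists fa lev, rooting G' 1 fa lev /\
      forall u w, lev u < lev w -> deg G' w <= deg G' u].
Proof.
pose bound := #|V| * (#|V| * #|V| ^ 2).
move: {2}(bound - edge_energy G) (ltnSn (bound - edge_energy G)) => m.
elim: m.+1 G => {m} [//|m IH] G en treeG; have [r cr] := exists_centroid treeG.
have rt := rooting_level treeG r; have lr := level_root G r.
case: (boolP [exists u, exists w, (level G r w == (level G r u).+1) && (deg G u < deg G w)]).
  case/existsP=> u /existsP[w /andP[/eqP luw duw]].
  have [G' [treeG' deg' le lt]] := improve rt lr cr luw duw.
  have [|//|G'' [tree'' deg'' le'' mono]] := IH G'.
    by have := edge_energy_bound G'; rewrite -/bound; lia.
  by exists G''; split=> //; [rewrite deg''|apply: walks_le_trans le le''].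
move=> good; exists G; split=> //; first by move=> k U; exists U.
exists (father G r), (level G r); split=> //; apply: (level_monotone rt) => u w luw.
rewrite leqNgt; apply: contra good => duw; apply/existsP; exists u; apply/existsP; exists w.
by rewrite luw eqxx.
Qed.

(** * Trees with degrees decreasing along the positions, compared with the greedy tree *)

(** The degrees read by position are a sorted permutation of all degrees. Two such trees with the
    same degree sequence therefore agree in degree position by position. *)
Lemma deg_at_pos (V : finType) (G : sgraph V) (pos : V -> nat) :
  injective pos -> (forall v, pos v < #|V|) ->
  (forall u v, pos u < pos v -> deg G v <= deg G u) ->
  forall v, deg G v = nth 0 (degree_sequence G) (pos v).
Proof.
move=> pinj plt anti v.
suff -> : degree_sequence G = map (at_pos pos (deg G)) (iota 0 #|V|).
  by rewrite (nth_map 0) ?size_iota // nth_iota // add0n at_posE.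
have tr : transitive geq by move=> a b c h1 h2; apply: leq_trans h2 h1.
apply: (sorted_eq tr); first by move=> a b; rewrite /= => h; apply/eqP; rewrite eqn_leq andbC.
- by apply: sort_sorted => a b; apply: leq_total.
- rewrite sorted_pairwise //; apply/(pairwiseP 0) => a b; rewrite !inE size_map size_iota => an bn ab.
  rewrite !(nth_map 0) ?size_iota // !nth_iota // !add0n /=.
  have [x px] := pos_onto pinj plt an; have [y py] := pos_onto pinj plt bn.
  by rewrite -px -py !at_posE //; apply: anti; rewrite px py.
- rewrite perm_sort.
  have -> : [seq deg G u | u : V] = map (at_pos pos (deg G)) (map pos (enum V)).
    by rewrite -map_comp; apply: eq_map => u /=; rewrite at_posE.
  apply: perm_map; apply: uniq_perm; [by rewrite map_inj_uniq // enum_uniq|exact: iota_uniq|].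
  move=> j; rewrite mem_iota add0n; apply/mapP/idP => [[u _ ->]|]; first exact: plt.
  by move=> jn; have [u pu] := pos_onto pinj plt jn; exists u; rewrite ?mem_enum.
Qed.

Lemma size_degree_sequence (V : finType) (G : sgraph V) : size (degree_sequence G) = #|V|.
Proof. by rewrite size_sort size_map -cardE. Qed.

Section Matching.
Variables (V : finType) (G : sgraph V) (fa : V -> V) (lev pos : V -> nat).
Hypotheses (rt : rooting G 1 fa lev) (lp : level_pos lev pos).
Hypothesis anti : forall u v, pos u < pos v -> deg G v <= deg G u.

Lemma lev_eq0_pos v : (lev v == 0) = (pos v == 0).
Proof. by have := lev_lt_pos lp 1 v; rewrite (below1 rt); lia. Qed.

Lemma card_children_deg v : #|children fa lev v| = deg G v - (pos v != 0).
Proof.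
rewrite (deg_children rt) -lev_eq0_pos; case: (posnP (lev v)) => lv.
  by rewrite (fa_root1 rt erefl lv) eqxx addn0 subn0.
by rewrite (adj_neq (adj_fa rt lv)) addnK.
Qed.

Lemma card_children_anti u v : pos u < pos v ->
  #|children fa lev v| <= #|children fa lev u|.
Proof. by move=> uv; have := anti uv; rewrite !card_children_deg; lia. Qed.

Lemma at_pos_children j : at_pos pos (fun v => #|children fa lev v|) j
  = if j < #|V| then nth 0 (degree_sequence G) j - (j != 0) else 0.
Proof.
case: ltnP => jn; last by rewrite /at_pos big_pred0 // => v; have := lp_lt lp v; lia.
have [v <-] := pos_onto (lp_inj lp) (lp_lt lp) jn; rewrite (at_posE (lp_inj lp)).
by rewrite card_children_deg (deg_at_pos (lp_inj lp) (lp_lt lp) anti).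
Qed.

End Matching.

(** Equal degrees at equal positions give equal numbers of children, and then levels of equal sizes
    by the recursion [belowS_children]. The two trees can thus be compared level by level from their
    vertex roots. *)
Lemma walks_le_matching (V W : finType) (G : sgraph V) (H : sgraph W) fa lev fa' lev' pos' :
  rooting G 1 fa lev -> (forall u w, lev u < lev w -> deg G w <= deg G u) ->
  rooting H 1 fa' lev' -> bfs_pos fa' lev' pos' ->
  (forall u v, pos' u < pos' v -> deg H v <= deg H u) ->
  degree_sequence G = degree_sequence H -> walks_le G H.
Proof.
move=> rt mono rt' bp anti' eqd.
have [pos lp dc] := exists_level_pos lev (fun v => #|children fa lev v|).
have anti u v : pos u < pos v -> deg G v <= deg G u.
  move=> uv; have := lp_lev lp (ltnW uv); rewrite leq_eqVlt => /orP[/eqP luv|/mono//].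
  rewrite !(deg_children rt); have /(_ luv uv) := dc u v.
  case: (posnP (lev u)) => lu; last by rewrite !(adj_neq (adj_fa rt _)) -?luv // leq_add2r.
  by rewrite !(fa_root1 rt erefl) ?eqxx ?addn0 // -luv.
have eq_at j : at_pos pos (fun v => #|children fa lev v|) j
    = at_pos pos' (fun v => #|children fa' lev' v|) j.
  rewrite (at_pos_children rt lp anti) (at_pos_children rt' bp anti') -eqd.
  by rewrite -(size_degree_sequence G) -(size_degree_sequence H) eqd.
have sumE (X : finType) (px h : X -> nat) q :
    \sum_(v | px v < q) h v = \sum_(j < q) at_pos px h j.
  transitivity (\sum_(v in [set v | 0 <= px v < 0 + q]) h v).
    by apply: eq_bigl => v; rewrite inE.
  by rewrite sum_interval.
have belowE i : below lev i = below lev' i.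
  elim: i => [|i IH]; first by rewrite /below !cards0.
  rewrite (belowS_children rt lp) (belowS_children rt' bp) !sumE IH.
  by congr (_ + _); apply: eq_bigr => j _; apply: eq_at.
have same i : #|level_set lev i| = #|level_set lev' i|.
  by have := belowE i.+1; rewrite !belowS belowE => /addnI.
have dom_c i : dom lev lev' pos' i (fun v => #|children fa lev v|) (fun w => #|children fa' lev' w|).
  move=> s sL; apply: leq_trans (leq_sum_window_top lp dc sL) _.
  rewrite /window !sum_interval belowE leq_eqVlt; apply/orP; left; apply/eqP.
  by apply: eq_bigr => j _; apply: eq_at.
have desc_c i : desc lev' pos' i (fun w => #|children fa' lev' w|).
  by move=> u v _ _; apply: (card_children_anti rt' bp anti').
by move=> k U; apply: (dom_global bp same) => i; exact: (dom_cwalks rt rt' bp same dom_c desc_c).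
Qed.

(** * Closed walks along the whole ordering, across levels *)

Section Antitone.
Variables (V : finType) (G : sgraph V) (fa : V -> V) (lev pos : V -> nat).
Hypotheses (rt : rooting G 1 fa lev) (bp : bfs_pos fa lev pos).
Hypothesis anti : forall u v, pos u < pos v -> deg G v <= deg G u.

Let treeG := rooting_tree rt.
Let before u v := pos u < pos v.

Let before_card u v : before u v -> #|children fa lev v| <= #|children fa lev u|.
Proof. exact: (card_children_anti rt bp anti). Qed.

Let before_children u v a b : before u v -> a \in children fa lev u ->
  b \in children fa lev v -> before a b.
Proof.
rewrite /before !inE => uv /andP[la /eqP fa_a] /andP[lb /eqP fa_b].
rewrite ltnNge leq_eqVlt; apply/negP => /orP[/eqP/(lp_inj bp) E|ba].
  by rewrite -fa_a -fa_b E ltnn in uv.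
by have := bp_fa bp ba lb la; rewrite fa_a fa_b leqNgt uv.
Qed.

Let dw_anti k u v : pos u < pos v -> dwalks G v (fa v) k <= dwalks G u (fa u) k.
Proof. exact: (dwalks_better rt before_card before_children). Qed.

Let sw_anti k u v : pos u < pos v -> swalks G v (fa v) k <= swalks G u (fa u) k.
Proof. exact: (swalks_better rt before_card before_children). Qed.

(** This identifies the first [r] vertices as a best choice, where comparisons inside levels do not
    suffice. For a non-root [u] the recursion is compared factor by factor, the father of an earlier
    vertex being no later. The root lacks the term of the father and is compared with its children
    first. *)
Lemma cwalks_anti k u v : pos u < pos v -> cwalks G v k <= cwalks G u k.
Proof.
elim/ltn_ind: k u v => -[|k] IH u v uv; first by rewrite !cwalks0.
have nonroot x y : 0 < lev x -> pos x < pos y -> cwalks G y k.+1 <= cwalks G x k.+1.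
  move=> lx xy; have ly := leq_trans lx (lp_lev bp (ltnW xy)).
  rewrite !(cwalks_nonroot rt) //; apply: leq_add.
    by apply: leq_conv => a ak; [apply: sw_anti|apply: IH => //; apply: leqW].
  apply: leq_conv => a ak; first exact: dw_anti.
  have := bp_fa bp xy lx ly; rewrite leq_eqVlt => /orP[/eqP/(lp_inj bp)->//|].
  by apply: IH; apply: leqW.
case: (posnP (lev u)) => lu; last exact: nonroot.
have lv : 0 < lev v.
  by rewrite lt0n (lev_eq0_pos rt bp); move: uv; case: (pos v).
have root_child b : lev b = 1 -> cwalks G b k.+1 <= cwalks G u k.+1.
  move=> lb; have fb : fa b = u by apply: (root_unique rt) => //; rewrite (rt_lev rt) lb.
  have ub : pos u < pos b.
    have := lev_eq0_pos rt bp u; have := lev_eq0_pos rt bp b; rewrite lu lb; lia.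
  have bu : adj G b u by rewrite -fb; apply: (adj_fa rt); rewrite lb.
  have ub' : adj G u b by rewrite adj_sym.
  (* The walks that begin by crossing the edge [ub] are equally many from both ends. What remains to
     compare are the branches at the root other than that of [b] and the branches of the children of
     [b]. *)
  rewrite (cwalksS treeG _ bu) (cwalksS treeG _ ub') nwalks_sym leq_add2r.
  apply: leq_conv => a ak; last by apply: IH => //; apply: leqW.
  rewrite -{1}fb (swalks_children rt).
  have bch : b \in children fa lev u by rewrite inE lb fb eqxx.
  have -> : swalks G u b a = \sum_(c in children fa lev u :\ b) dwalks G c (fa c) a.
    have fu : fa u = u by apply: (fa_root1 rt).
    apply: eq_big => c; first by rewrite in_setD1 (childrenE rt) fu andbC; case: (c =P u) => [->|]; rewrite ?adj_irr ?andbT ?andbF.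
    case/andP=> uc _; suff -> : fa c = u by [].
    have : c \in children fa lev u by rewrite (childrenE rt) fu uc eq_sym (adj_neq uc).
    by rewrite inE => /andP[_ /eqP].
  apply: leq_sum_cross.
    rewrite -(leq_add2l 1) -[1 in leqRHS](_ : (b \in children fa lev u) = 1 :> nat); last by rewrite bch.
    rewrite -cardsD1 !(card_children_deg rt bp).
    have := anti ub; have := lev_eq0_pos rt bp u; have := lev_eq0_pos rt bp b; rewrite lu lb.
    have : 0 < deg G b by apply/card_gt0P; exists u; rewrite inE.
    lia.
  move=> c d; rewrite in_setD1 => /andP[_ cu] db; apply: dw_anti.
  exact: before_children ub cu db.
have [lv1|lv2] := leqP (lev v) 1; first by apply: root_child; lia.
(* The ancestor of [v] on level 1 mediates between [v] and the root. *)
pose b := iter (lev v).-1 fa v.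
have lb : lev b = 1 by rewrite (lev_iter rt); lia.
apply: leq_trans (nonroot b v _ _) (root_child b lb); first by rewrite lb.
by rewrite ltnNge; apply/negP => /(lp_lev bp); rewrite lb; lia.
Qed.

End Antitone.

(** * From a BFS-ordering to numerical positions *)

Section Prec.
Variables (W : finType) (H : sgraph W) (root : W) (prec : rel W).
Hypotheses (bfs : bfs_ordering H root prec) (treeH : is_tree H).
Hypothesis deg_level : forall u v, level H root v = (level H root u).+1 -> deg H v <= deg H u.

(** The rank in the ordering, counted from 0; with it, [first_vertices prec r] is by definition the
    set of positions less than [r]. *)
Definition prec_pos v := #|[set u | prec u v]|.

Let rt := rooting_level treeH root.

Lemma prec_posE u v : (prec_pos u < prec_pos v) = prec u v.
Proof.
have [[irr tr tot] _ _] := bfs.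
have lt x y : prec x y -> prec_pos x < prec_pos y.
  move=> xy; apply: proper_card; apply/properP; split.
    by apply/subsetP => z; rewrite !inE => zx; apply: tr zx xy.
  by exists x; rewrite !inE ?irr.
apply/idP/idP => [uv|]; last exact: lt.
have nuv : u != v by apply: contraTneq uv => ->; rewrite ltnn.
by case/orP: (tot _ _ nuv) => // /lt; rewrite ltnNge ltnW.
Qed.

Lemma prec_level u v : prec u v -> level H root u <= level H root v.
Proof.
have [[irr tr _] lev_prec _] := bfs.
by move=> uv; rewrite leqNgt; apply/negP => /lev_prec vu; have := tr _ _ _ uv vu; rewrite irr.
Qed.

Lemma bfs_pos_prec : bfs_pos (father H root) (level H root) prec_pos.
Proof.
have [[irr tr tot] lev_prec same] := bfs.
split; first split.
- move=> u v E; apply/eqP/negPn/negP => nuv.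
  by case/orP: (tot _ _ nuv); rewrite -prec_posE E ltnn.
- move=> v; rewrite -cardsT; apply: proper_card; apply/properP; split; first exact: subsetT.
  by exists v; rewrite !inE ?irr.
- move=> u v; rewrite leqNgt prec_posE => nvu; rewrite leqNgt; apply: contra nvu => /lev_prec.
  by [].
move=> u v; rewrite prec_posE => uv lu lv.
have := prec_level uv; rewrite leq_eqVlt => /orP[/eqP luv|luv].
  have nroot x : 0 < level H root x -> x != root.
    by apply: contraTneq => ->; rewrite level_root.
  have [_ /(_ (nroot _ lu) (nroot _ lv))] := same _ _ uv luv.
  by case=> [->//|]; rewrite -prec_posE => /ltnW.
apply: ltnW; rewrite prec_posE; apply: lev_prec.
by rewrite !(rt_lev rt); lia.
Qed.

Lemma deg_prec_anti u v : prec_pos u < prec_pos v -> deg H v <= deg H u.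
Proof.
rewrite prec_posE => uv; have := prec_level uv; rewrite leq_eqVlt => /orP[/eqP luv|].
  by have [_ _ same] := bfs; have [] := same _ _ uv luv.
exact: (level_monotone rt).
Qed.

Lemma first_verticesE r : first_vertices prec r = [set v | prec_pos v < r].
Proof. by []. Qed.

End Prec.

(** * Sorted sequences of closed walk numbers, and their maximal partial sums *)

Lemma closed_walks_cwalks (V : finType) (G : sgraph V) k v : closed_walks G k v = cwalks G v k.
Proof. exact: closed_walksE. Qed.

(** The bridge between the sorted sequences of [weakly_majorized] and the sets of vertices used by
    [walks_le]. *)
Lemma sorted_prefix (V : finType) (f : V -> nat) t : t <= #|V| ->
  exists2 A : {set V}, #|A| = t &
    \sum_(i < t) nth 0 (sort geq [seq f v | v : V]) i = \sum_(v in A) f v /\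
    forall B : {set V}, #|B| = t -> \sum_(v in B) f v <= \sum_(v in A) f v.
Proof.
move=> tn; pose l := sort (fun u v => f v <= f u) (enum V).
have El : sort geq [seq f v | v : V] = map f l by rewrite sort_map.
have ul : uniq l by rewrite sort_uniq enum_uniq.
have sl : size l = #|V| by rewrite size_sort -cardE.
have cA : #|[set v in take t l]| = t.
  by rewrite cardsE (card_uniqP _) ?take_uniq // size_takel // sl.
exists [set v in take t l] => //; split.
  rewrite (eq_bigl [in take t l]) => [|v]; last by rewrite inE.
  rewrite -big_uniq ?take_uniq //= El -(big_map f xpredT id) map_take.
  rewrite (big_nth 0) size_takel ?size_map ?sl // big_mkord.
  by apply: eq_bigr => i _; rewrite nth_take.
move=> B cB; apply: leq_sum_top; first by rewrite cA.
move=> a b; rewrite !inE => al _ bl.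
have ml x : x \in l by rewrite mem_sort mem_enum.
rewrite -(nth_index a (ml a)) -(nth_index a (ml b)).
move: al bl; rewrite !in_take // -leqNgt => al bl.
by apply: sort_desc_nth; [apply: leq_trans al bl|rewrite index_mem].
Qed.

Theorem theorem2p3 (pi : seq nat) (hpi : tree_degree_sequence pi)
    (W : finType) (Tstar : sgraph W) (root : W)
    (hgreedy : greedy_tree Tstar root) (hdeg : degree_sequence Tstar = pi)
    (k : nat) :
  (forall (V : finType) (T : sgraph V), in_trees pi T ->
     weakly_majorized (closed_walk_seq T k) (closed_walk_seq Tstar k))
  /\
  (forall prec : rel W, bfs_ordering Tstar root prec ->
   forall r : nat, r < size pi ->
     is_maximum
       (fun m => exists (V : finType) (T : sgraph V), in_trees pi T /\
          m = \max_(U : {set V} | #|U| == r) \sum_(v in U) closed_walks T k v)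
       (\sum_(v in first_vertices prec r) closed_walks Tstar k v)).
Proof.
have [treeS [prec0 bfs0] deg_level] := hgreedy.
have rtS := rooting_level treeS root.
have all_le (V : finType) (T : sgraph V) : in_trees pi T -> walks_le T Tstar.
  case=> treeT degT; have [G [_ degG TG [fa [lev [rt mono]]]]] := exists_level_monotone treeT.
  apply: walks_le_trans TG _.
  apply: (walks_le_matching rt mono rtS (bfs_pos_prec bfs0 treeS)).
    exact: (deg_prec_anti bfs0 treeS deg_level).
  by rewrite degG degT hdeg.
have card_pi V (T : sgraph V) : in_trees pi T -> #|V| = size pi.
  by case=> _ <-; rewrite size_degree_sequence.
have inS : in_trees pi Tstar by [].
split=> [V T inT|prec bfs r rn].
  have sz X (G : sgraph X) : size (closed_walk_seq G k) = #|X| by rewrite size_map -cardE.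
  split; first by rewrite !sz (card_pi _ _ inT) (card_pi _ _ inS).
  move=> t; rewrite sz => tV.
  have [A cA [-> _]] := sorted_prefix (closed_walks T k) tV.
  have tW : t.+1 <= #|W| by rewrite (card_pi _ _ inS) -(card_pi _ _ inT).
  have [B cB [-> maxB]] := sorted_prefix (closed_walks Tstar k) tW.
  have [U' cU' le] := all_le _ _ inT k A.
  under eq_bigr do rewrite closed_walks_cwalks.
  apply: leq_trans le _; under eq_bigr do rewrite -closed_walks_cwalks.
  by apply: maxB; rewrite cU'.
have bp := bfs_pos_prec bfs treeS; have anti := deg_prec_anti bfs treeS deg_level.
have cF : #|first_vertices prec r| = r.
  by rewrite first_verticesE (card_pos_lt (lp_inj bp) (lp_lt bp)) // (card_pi _ _ inS) ltnW.
have maxF (U : {set W}) : #|U| = r -> \sum_(v in U) closed_walks Tstar k v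
    <= \sum_(v in first_vertices prec r) closed_walks Tstar k v.
  move=> cU; apply: leq_sum_top; first by rewrite cF.
  move=> a b; rewrite !inE -leqNgt => ar _ br; rewrite !closed_walks_cwalks.
  by apply: (cwalks_anti rtS bp anti); apply: leq_trans ar br.
split.
  exists W, Tstar; split=> //; apply/eqP; rewrite eqn_leq; apply/andP; split.
    apply: (@leq_bigmax_cond _ (fun U : {set W} => #|U| == r)
      (fun U => \sum_(v in U) closed_walks Tstar k v)).
    exact/eqP.
  by apply/bigmax_leqP => U /eqP/maxF.
move=> _ [V [T [inT ->]]]; apply/bigmax_leqP => U /eqP cU.
have [U' cU' le] := all_le _ _ inT k U.
apply: leq_trans (maxF U' _); last by rewrite cU'.
under eq_bigr do rewrite closed_walks_cwalks.
by under [leqRHS]eq_bigr do rewrite closed_walks_cwalks.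
Qed.
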